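(* Let $P(\theta)=\sum_{l=-L}^{L}a_le^{il\theta}$ be the generating function of an isotropic continuous-time quantum walk with finite support on $\mathbb{Z}$ started from the origin. Let the equation $P'(\theta)=0$ have $K>0$ real solutions $\theta_k$, $k=1,\dots,K$, in the interval $[0,2\pi)$ and assume that the values $P(\theta_k)$ are all different. Then the average probability of the return to zero is $$\overline{p_0}(t)=\frac{1}{2\pi t}\sum_{k=1}^{K}\frac{1}{|P''(\theta_k)|}+O\!\left(\frac{1}{t^{3/2}}\right).$$
   Context: Let $\delta_l$, $l\in\mathbb{Z}$, be the delta function on $\mathbb{Z}$ concentrated at $l$, regarded as an element of $L^2(\mathbb{Z})=\ell^2(\mathbb{Z})$. A quantum walk on $\mathbb{Z}$ is given by a Hermitian operator $X$ on $L^2(\mathbb{Z})$ with matrix entries $X_{ij}$ and has evolution $U_t=\exp(itX)$; the amplitude of return to $0$ is $\psi_0(t)=\langle\delta_0,U_t\delta_0\rangle$. The walk has finite support if there is a constant $L$ such that $X_{ij}=0$ whenever $|i-j|>L$. It is isotropic if $X_{ij}=a_{i-j}$ and $a_{-l}=\overline{a_l}$ for certain constants $a_l$. The average probability of return is the average of $|\psi_0|^2$ over the time window $[t,t+\sqrt t]$, i.e. $\overline{p_0}(t)=\frac{1}{\sqrt t}\int_t^{t+\sqrt t}|\psi_0(s)|^2\,ds$, and the $O$-term refers to $t\to\infty$.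
   Formalization: The formal theorem adds the assumption P''(θ_k) ≠ 0 for every k, without which 1/|P''(θ_k)| is undefined, e.g. for P(θ) = −cos θ + (1/4)cos 2θ at θ = 0. *)

(* Defs.v *)
From Stdlib Require Import Reals ZArith Lra Lia.
From Coquelicot Require Import Coquelicot.
Local Open Scope R_scope.

(** Series over [Z] are the series of symmetric partial sums; term [n] groups
    the indices [n] and [-n].  Only absolutely convergent sums occur below, so
    the order of summation is immaterial. *)
Definition zfold {G : AbelianMonoid} (u : Z -> G) (n : nat) : G :=
  match n with
  | O => u 0%Z
  | S _ => plus (u (Z.of_nat n)) (u (- Z.of_nat n)%Z)
  end.

(** Coquelicot's total [Series] is real-valued, hence the pair. *)
Definition CSeries (u : nat -> C) : C :=
  (Series (fun n => Re (u n)), Series (fun n => Im (u n))).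

Definition ZCSeries (u : Z -> C) : C := CSeries (zfold u).

Definition l2 (f : Z -> C) : Prop := ex_series (zfold (fun i => Cmod (f i) ^ 2)).

Definition l2norm (f : Z -> C) : R :=
  sqrt (Series (zfold (fun i => Cmod (f i) ^ 2))).

Definition inner (f g : Z -> C) : C := ZCSeries (fun i => (Cconj (f i) * g i)%C).

Definition delta (l : Z) : Z -> C := fun i => if Z.eq_dec i l then 1%C else 0%C.

Definition hermitian (X : Z -> Z -> C) : Prop :=
  forall i j, X i j = Cconj (X j i).

Definition finite_support (X : Z -> Z -> C) (L : nat) : Prop :=
  forall i j, (Z.abs (i - j) > Z.of_nat L)%Z -> X i j = 0%C.

Definition isotropic (X : Z -> Z -> C) (a : Z -> C) : Prop :=
  (forall i j, X i j = a (i - j)%Z) /\ (forall l, a (- l)%Z = Cconj (a l)).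

Definition act (X : Z -> Z -> C) (f : Z -> C) : Z -> C :=
  fun i => ZCSeries (fun j => (X i j * f j)%C).

(** The exponential series of an operator.  The sum is evaluated entry by entry;
    for a bounded [A] this is the limit of the partial sums in the operator norm
    of l^2(Z), see [op_exp_norm_limit] and [evolution_norm_limit] below. *)
Definition op_exp_term (A : (Z -> C) -> (Z -> C)) (f : Z -> C) (i : Z) (n : nat) : C :=
  (Nat.iter n A f i / RtoC (INR (fact n)))%C.

Definition op_exp (A : (Z -> C) -> (Z -> C)) (f : Z -> C) : Z -> C :=
  fun i => CSeries (op_exp_term A f i).

Definition evolution (X : Z -> Z -> C) (t : R) : (Z -> C) -> (Z -> C) :=
  op_exp (fun f i => (Ci * RtoC t * act X f i)%C).

Definition psi0 (X : Z -> Z -> C) (t : R) : C :=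
  inner (delta 0) (evolution X t (delta 0)).

Definition avg_return_prob (X : Z -> Z -> C) (t : R) : R :=
  / sqrt t * RInt (fun s => Cmod (psi0 X s) ^ 2) t (t + sqrt t).

Definition cis (x : R) : C := (cos x, sin x).

Definition genfun (a : Z -> C) (L : nat) (theta : R) : C :=
  sum_n (fun n => let l := (Z.of_nat n - Z.of_nat L)%Z in
                  (a l * cis (IZR l * theta))%C) (2 * L).

(** When [a (- l) = Cconj (a l)] the generating function takes real values
    ([genfun_real] below); this is the corresponding function [R -> R]. *)
Definition rgenfun (a : Z -> C) (L : nat) (theta : R) : R := Re (genfun a L theta).

Definition bigO_infty (f g : R -> R) : Prop :=
  exists M T : R, forall t, T <= t -> Rabs (f t) <= M * Rabs (g t).

Lemma sum_n_Cre (u : nat -> C) n : Re (sum_n u n) = sum_n (fun k => Re (u k)) n.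
Proof.
induction n as [|n IH]; [now rewrite !sum_O|].
rewrite !sum_Sn, <- IH; reflexivity.
Qed.

Lemma sum_n_Cim (u : nat -> C) n : Im (sum_n u n) = sum_n (fun k => Im (u k)) n.
Proof.
induction n as [|n IH]; [now rewrite !sum_O|].
rewrite !sum_Sn, <- IH; reflexivity.
Qed.

Lemma sum_n_rev (u : nat -> R) n : sum_n u n = sum_n (fun k => u (n - k)%nat) n.
Proof.
revert u; induction n as [|n IH]; intros u; [now rewrite !sum_O|].
rewrite sum_Sn, (IH u).
unfold sum_n at 2; rewrite sum_Sn_m by lia.
rewrite <- sum_n_m_S, plus_comm; f_equal.
Qed.

Lemma genfun_real (X : Z -> Z -> C) (a : Z -> C) (L : nat) (theta : R) :
  isotropic X a -> genfun a L theta = RtoC (rgenfun a L theta).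
Proof.
intros [_ Ha]; unfold rgenfun.
assert (H : Im (genfun a L theta) = 0).
{ unfold genfun; rewrite sum_n_Cim.
  set (u := fun k : nat => Im _).
  assert (E : sum_n u (2 * L) = - sum_n u (2 * L)).
  { rewrite sum_n_rev at 1.
    transitivity (sum_n (fun k => scal (-1) (u k)) (2 * L)).
    - apply sum_n_ext_loc; intros k Hk; unfold u.
      replace (Z.of_nat (2 * L - k) - Z.of_nat L)%Z
        with (- (Z.of_nat k - Z.of_nat L))%Z by lia.
      rewrite Ha, opp_IZR.
      set (x := IZR _); replace (- x * theta) with (- (x * theta)) by ring.
      unfold scal; simpl; unfold mult; simpl.
      rewrite cos_neg, sin_neg; ring.
    - etransitivity; [exact (sum_n_scal_l (-1 : R) u (2 * L))|].
      change (-1 * sum_n u (2 * L) = - sum_n u (2 * L)); ring. }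
  lra. }
destruct (genfun a L theta) as [x y]; simpl in *; now rewrite H.
Qed.

Lemma bounded_series (v : nat -> R) (B : R) :
  (forall n, 0 <= v n) -> (forall n, sum_n v n <= B) ->
  ex_series v /\ Series v <= B.
Proof.
intros Hv HB.
assert (E : ex_finite_lim_seq (sum_n v)).
{ apply (ex_finite_lim_seq_incr _ B); [|exact HB].
  intros n; rewrite sum_Sn; unfold plus; simpl; generalize (Hv (S n)); lra. }
split.
- destruct E as [l Hl]; exists l; exact Hl.
- destruct E as [l Hl].
  assert (Series v = l) as -> by (apply is_series_unique; exact Hl).
  assert (H : Rbar_le l B).
  { apply (is_lim_seq_le (sum_n v) (fun _ => B)); auto using is_lim_seq_const. }
  exact H.
Qed.

Lemma partial_le_Series (v : nat -> R) n :
  (forall n, 0 <= v n) -> ex_series v -> sum_n v n <= Series v.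
Proof.
intros Hv E.
assert (H : is_lim_seq (sum_n v) (Series v)) by (exact (Series_correct v E)).
apply (is_lim_seq_incr_compare _ _ H).
intros m; rewrite sum_Sn; unfold plus; simpl; generalize (Hv (S m)); lra.
Qed.

Lemma ex_series_dom (u v : nat -> R) :
  (forall n, Rabs (u n) <= v n) -> ex_series v -> ex_series u.
Proof. intros H E; apply (ex_series_le u v); [exact H | exact E]. Qed.

Lemma Cmod_le_abs (z : C) : Cmod z <= Rabs (fst z) + Rabs (snd z).
Proof.
destruct z as [x y]; unfold Cmod; simpl.
assert (Hx := Rabs_pos x); assert (Hy := Rabs_pos y).
rewrite <- (sqrt_Rsqr (Rabs x + Rabs y)) by lra.
apply sqrt_le_1_alt; unfold Rsqr.
assert (Ex : x * x = Rabs x * Rabs x) by (rewrite <- Rabs_mult, Rabs_pos_eq; nra).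
assert (Ey : y * y = Rabs y * Rabs y) by (rewrite <- Rabs_mult, Rabs_pos_eq; nra).
nra.
Qed.

Lemma Cmod_CSeries_le (u : nat -> C) (v : nat -> R) :
  (forall n, Cmod (u n) <= v n) -> ex_series v ->
  Cmod (CSeries u) <= 2 * Series v.
Proof.
intros H E.
assert (Hre : forall n, 0 <= Rabs (Re (u n)) <= v n).
{ intros n; split; [apply Rabs_pos|].
  eapply Rle_trans; [|apply H]; eapply Rle_trans; [apply Rmax_l | apply Rmax_Cmod]. }
assert (Him : forall n, 0 <= Rabs (Im (u n)) <= v n).
{ intros n; split; [apply Rabs_pos|].
  eapply Rle_trans; [|apply H]; eapply Rle_trans; [apply Rmax_r | apply Rmax_Cmod]. }
assert (Ere : ex_series (fun n => Rabs (Re (u n)))).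
{ apply (ex_series_dom _ v); [|exact E].
  intros n; rewrite Rabs_Rabsolu; apply Hre. }
assert (Eim : ex_series (fun n => Rabs (Im (u n)))).
{ apply (ex_series_dom _ v); [|exact E].
  intros n; rewrite Rabs_Rabsolu; apply Him. }
assert (A1 := Series_Rabs _ Ere); assert (A2 := Series_Rabs _ Eim).
assert (B1 := Series_le _ _ Hre E); assert (B2 := Series_le _ _ Him E).
assert (T := Cmod_le_abs (CSeries u)); unfold CSeries in T; simpl fst in T; simpl snd in T.
unfold CSeries; lra.
Qed.

Lemma weighted_cauchy_schwarz (c q x : nat -> R) (B : R) :
  0 < B -> (forall n, 0 <= c n) -> (forall n, 0 <= q n) -> (forall n, 0 <= x n) ->
  (forall n, x n ^ 2 <= c n * q n) -> ex_series c -> ex_series q -> Series c <= B ->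
  ex_series x /\ Series x ^ 2 <= B * Series q.
Proof.
intros HB Hc Hq Hx H Ec Eq Sc.
assert (K : forall lam n, 0 <= lam -> 2 * lam * x n <= lam ^ 2 * c n + q n).
{ intros lam n Hl.
  assert (h1 := Hc n); assert (h2 := Hq n); assert (h3 := Hx n); assert (h4 := H n).
  assert (P1 : 0 <= lam ^ 2 * c n) by (apply Rmult_le_pos; nra).
  apply Rsqr_incr_0_var; [unfold Rsqr | lra].
  assert (P2 : lam ^ 2 * (x n ^ 2) <= lam ^ 2 * (c n * q n)) by (apply Rmult_le_compat_l; nra).
  assert (P3 := pow2_ge_0 (lam ^ 2 * c n - q n)).
  ring_simplify in P3; ring_simplify in P2; ring_simplify; lra. }
assert (Ex : ex_series x).
{ apply (ex_series_dom _ (fun n => c n + q n)); [|exact (ex_series_plus c q Ec Eq)].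
  intros n; rewrite Rabs_pos_eq by apply Hx.
  generalize (K 1 n ltac:(lra)) (Hc n) (Hq n) (Hx n); lra. }
split; [exact Ex|].
assert (Sx : 0 <= Series x).
{ generalize (partial_le_Series x 0 Hx Ex) (Hx 0%nat); rewrite sum_O; lra. }
set (s := Series x) in *.
assert (Hl : 0 <= s / B) by (apply Rdiv_le_0_compat; lra).
assert (Q : 2 * (s / B) * s <= (s / B) ^ 2 * Series c + Series q).
{ unfold s at 2; rewrite <- !Series_scal_l.
  rewrite <- Series_plus; [|apply (ex_series_scal_l _ c Ec)|exact Eq].
  apply Series_le.
  - intros n; split; [|apply K, Hl].
    apply Rmult_le_pos; [lra | apply Hx].
  - apply (ex_series_plus (fun n => (s / B) ^ 2 * c n) q);
      [apply (ex_series_scal_l _ c Ec)|exact Eq]. }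
assert (Q2 : (s / B) ^ 2 * Series c <= (s / B) ^ 2 * B) by (apply Rmult_le_compat_l; nra).
assert (Q3 : s ^ 2 / B <= Series q).
{ replace (s ^ 2 / B) with (2 * (s / B) * s - (s / B) ^ 2 * B) by (field; lra). lra. }
apply (Rmult_le_compat_l B) in Q3; [|lra].
replace (s ^ 2) with (B * (s ^ 2 / B)) by (field; lra). exact Q3.
Qed.

Lemma zfold_le (u v : Z -> R) n : (forall i, u i <= v i) -> zfold u n <= zfold v n.
Proof.
intros H; destruct n; simpl; [apply H|].
unfold plus; simpl; apply Rplus_le_compat; apply H.
Qed.

Lemma zfold_pos (u : Z -> R) n : (forall i, 0 <= u i) -> 0 <= zfold u n.
Proof.
intros H; destruct n; simpl; [apply H|].
unfold plus; simpl; apply Rplus_le_le_0_compat; apply H.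
Qed.

Lemma zfold_scal (b : R) (u : Z -> R) n : zfold (fun i => b * u i) n = b * zfold u n.
Proof. destruct n; simpl; [reflexivity|]; unfold plus; simpl; ring. Qed.

Lemma window_le (u v : Z -> R) n :
  (forall i, u i <= v i) -> sum_n (zfold u) n <= sum_n (zfold v) n.
Proof. intros H; apply sum_n_m_le; intros k; now apply zfold_le. Qed.

Lemma window_scal (b : R) (u : Z -> R) n :
  sum_n (zfold (fun i => b * u i)) n = b * sum_n (zfold u) n.
Proof.
transitivity (sum_n (fun k => scal b (zfold u k)) n).
- apply sum_n_ext; intros k; apply zfold_scal.
- exact (sum_n_scal_l b (zfold u) n).
Qed.

Lemma window_zfold (F : Z -> Z -> R) n m :
  sum_n (zfold (fun i => zfold (F i) m)) n
  = zfold (fun j => sum_n (zfold (fun i => F i j)) n) m.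
Proof.
induction n as [|n IH].
- rewrite sum_O; destruct m; simpl; rewrite ?sum_O; reflexivity.
- rewrite sum_Sn, IH; destruct m; simpl; rewrite !sum_Sn; simpl;
    unfold plus; simpl; ring.
Qed.

Lemma window_Series (F : Z -> nat -> R) n :
  (forall i, ex_series (F i)) ->
  ex_series (fun m => sum_n (zfold (fun i => F i m)) n) /\
  sum_n (zfold (fun i => Series (F i))) n
  = Series (fun m => sum_n (zfold (fun i => F i m)) n).
Proof.
intros E.
assert (Z1 : forall k, is_series (fun m => zfold (fun i => F i m) k)
                                 (zfold (fun i => Series (F i)) k)).
{ intros [|k]; simpl; [apply Series_correct, E|].
  apply (is_series_plus (F (Z.of_nat (S k))) (F (- Z.of_nat (S k))%Z));
    apply Series_correct, E. }
assert (I : is_series (fun m => sum_n (zfold (fun i => F i m)) n)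
                      (sum_n (zfold (fun i => Series (F i))) n)).
{ induction n as [|n IH].
  - rewrite sum_O; eapply is_series_ext; [|apply (Z1 0%nat)].
    intros m; now rewrite sum_O.
  - rewrite sum_Sn; eapply is_series_ext; [|exact (is_series_plus _ _ _ _ IH (Z1 (S n)))].
    intros m; now rewrite sum_Sn. }
split; [now exists (sum_n (zfold (fun i => Series (F i))) n)|].
symmetry; now apply is_series_unique.
Qed.

Lemma sq_pos (x : R) : 0 <= x ^ 2.
Proof. apply pow2_ge_0. Qed.

Lemma l2_sum_pos (f : Z -> C) : l2 f -> 0 <= Series (zfold (fun i => Cmod (f i) ^ 2)).
Proof.
intros E.
assert (P : forall n, 0 <= zfold (fun i => Cmod (f i) ^ 2) n)
  by (intros n; apply zfold_pos; intros; apply sq_pos).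
generalize (partial_le_Series _ 0 P E) (P 0%nat); rewrite sum_O; lra.
Qed.

Lemma l2norm_sq (f : Z -> C) :
  l2 f -> l2norm f ^ 2 = Series (zfold (fun i => Cmod (f i) ^ 2)).
Proof. intros E; apply pow2_sqrt, l2_sum_pos, E. Qed.

Lemma window_le_l2norm (f : Z -> C) n :
  l2 f -> sum_n (zfold (fun i => Cmod (f i) ^ 2)) n <= l2norm f ^ 2.
Proof.
intros E; rewrite l2norm_sq by exact E; apply partial_le_Series; [|exact E].
intros; apply zfold_pos; intros; apply sq_pos.
Qed.

Lemma l2_of_windows (f : Z -> C) (B : R) :
  0 <= B -> (forall n, sum_n (zfold (fun i => Cmod (f i) ^ 2)) n <= B ^ 2) ->
  l2 f /\ l2norm f <= B.
Proof.
intros HB H.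
destruct (bounded_series (zfold (fun i => Cmod (f i) ^ 2)) (B ^ 2)) as [E S].
- intros; apply zfold_pos; intros; apply sq_pos.
- exact H.
- split; [exact E|].
  unfold l2norm; rewrite <- (sqrt_pow2 B HB); now apply sqrt_le_1_alt.
Qed.

Lemma window_term (u : Z -> R) i :
  (forall i, 0 <= u i) -> u i <= sum_n (zfold u) (Z.abs_nat i).
Proof.
intros H.
assert (P : forall n, 0 <= sum_n (zfold u) n).
{ induction n as [|n IH]; [rewrite sum_O; now apply zfold_pos|].
  rewrite sum_Sn; apply Rplus_le_le_0_compat; [exact IH | now apply zfold_pos]. }
destruct (Z.abs_nat i) as [|n] eqn:En.
- rewrite sum_O; simpl; replace i with 0%Z by lia; lra.
- rewrite sum_Sn; unfold plus; simpl; unfold plus; simpl.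
  assert (i = Z.of_nat (S n) \/ i = (- Z.of_nat (S n))%Z) as [-> | ->] by lia;
    [generalize (P n) (H (- Z.of_nat (S n))%Z) | generalize (P n) (H (Z.of_nat (S n)))];
    simpl; lra.
Qed.

Lemma Cmod_le_l2norm (f : Z -> C) i : l2 f -> Cmod (f i) <= l2norm f.
Proof.
intros E; apply Rsqr_incr_0_var; [|apply sqrt_pos].
rewrite !Rsqr_pow2; eapply Rle_trans; [|apply (window_le_l2norm f (Z.abs_nat i) E)].
apply (window_term (fun i => Cmod (f i) ^ 2)); intros; apply sq_pos.
Qed.

(** Schur test; the factor [2] comes from the real and imaginary parts in [CSeries]. *)
Lemma act_bounded_schur (X : Z -> Z -> C) (B : R) :
  0 < B ->
  (forall i n, sum_n (zfold (fun j => Cmod (X i j))) n <= B) ->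
  (forall j n, sum_n (zfold (fun i => Cmod (X i j))) n <= B) ->
  forall f, l2 f -> l2 (act X f) /\ l2norm (act X f) <= 2 * B * l2norm f.
Proof.
intros HB Hrow Hcol f Hf.
assert (W0 : forall i j, 0 <= Cmod (X i j)) by (intros; apply Cmod_ge_0).
assert (WB : forall i j, Cmod (X i j) <= B).
{ intros i j; eapply Rle_trans; [|apply (Hrow i (Z.abs_nat j))].
  now apply (window_term (fun j => Cmod (X i j))). }
set (c := fun i => zfold (fun j => Cmod (X i j))).
set (q := fun i => zfold (fun j => Cmod (X i j) * Cmod (f j) ^ 2)).
set (x := fun i => zfold (fun j => Cmod (X i j) * Cmod (f j))).
assert (Q0 : forall i n, 0 <= q i n).
{ intros; apply zfold_pos; intros; apply Rmult_le_pos; [apply W0 | apply sq_pos]. }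
assert (Eq : forall i, ex_series (q i)).
{ intros i; apply (ex_series_dom _ (fun n => B * zfold (fun j => Cmod (f j) ^ 2) n)).
  - intros n; rewrite Rabs_pos_eq by apply Q0; rewrite <- zfold_scal; apply zfold_le.
    intros j; apply Rmult_le_compat_r; [apply sq_pos | apply WB].
  - apply (ex_series_scal_l B _ Hf). }
assert (Pt : forall i, Cmod (act X f i) ^ 2 <= 4 * B * Series (q i)).
{ intros i.
  destruct (bounded_series (c i) B) as [Ec Sc].
  { intros; now apply zfold_pos. }
  { apply Hrow. }
  destruct (weighted_cauchy_schwarz (c i) (q i) (x i) B) as [Ex Sx]; auto.
  { intros; now apply zfold_pos. }
  { intros; apply zfold_pos; intros; apply Rmult_le_pos; [apply W0 | apply Cmod_ge_0]. }
  { intros [|n]; unfold c, q, x; simpl.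
    - right; ring.
    - unfold plus; simpl.
      generalize (Cmod (f (Z.pos (Pos.of_succ_nat n)))) (Cmod (f (Z.neg (Pos.of_succ_nat n))))
        (W0 i (Z.pos (Pos.of_succ_nat n))) (W0 i (Z.neg (Pos.of_succ_nat n))).
      generalize (Cmod (X i (Z.pos (Pos.of_succ_nat n)))) (Cmod (X i (Z.neg (Pos.of_succ_nat n)))).
      intros w1 w2 f1 f2 H1 H2.
      assert (0 <= w1 * w2 * (f1 - f2) ^ 2)
        by (apply Rmult_le_pos; [now apply Rmult_le_pos | apply sq_pos]).
      nra. }
  assert (M : Cmod (act X f i) <= 2 * Series (x i)).
  { apply Cmod_CSeries_le; [|exact Ex].
    intros [|n]; unfold x; simpl; [rewrite Cmod_mult; lra|].
    eapply Rle_trans; [apply Cmod_triangle|]; rewrite !Cmod_mult; unfold plus; simpl; lra. }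
  assert (0 <= Cmod (act X f i)) by apply Cmod_ge_0.
  nra. }
apply l2_of_windows.
{ apply Rmult_le_pos; [lra | apply sqrt_pos]. }
intros n.
eapply Rle_trans; [apply window_le, Pt|].
rewrite window_scal.
destruct (window_Series q n Eq) as [E1 ->].
assert (S1 : Series (fun m => sum_n (zfold (fun i => q i m)) n) <= B * l2norm f ^ 2).
{ rewrite l2norm_sq by exact Hf; rewrite <- Series_scal_l; apply Series_le.
  - intros m; split.
    + rewrite <- (Rmult_0_l (sum_n (zfold (fun i => 0)) n)), <- window_scal.
      apply window_le; intros i; rewrite Rmult_0_l; apply Q0.
    + unfold q; rewrite (window_zfold (fun i j => Cmod (X i j) * Cmod (f j) ^ 2)).
      rewrite <- zfold_scal; apply zfold_le; intros j.
      rewrite (sum_n_ext _ (zfold (fun i => Cmod (f j) ^ 2 * Cmod (X i j)))).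
      * rewrite window_scal, Rmult_comm; apply Rmult_le_compat_r; [apply sq_pos | apply Hcol].
      * intros [|k]; simpl; unfold plus; simpl; ring.
  - apply (ex_series_scal_l B _ Hf). }
apply (Rmult_le_compat_l (4 * B)) in S1; [|lra].
eapply Rle_trans; [exact S1|]; right; ring.
Qed.

Ltac decide_Z :=
  repeat match goal with
  | |- context [Z.eq_dec ?x ?y] => destruct (Z.eq_dec x y)
  | |- context [Z_le_dec ?x ?y] => destruct (Z_le_dec x y)
  end.

Lemma window_dirac (b : R) (j0 : Z) n :
  0 <= b -> sum_n (zfold (fun j => if Z.eq_dec j j0 then b else 0)) n <= b.
Proof.
intros Hb.
assert (H : sum_n (zfold (fun j => if Z.eq_dec j j0 then b else 0)) n
            = if Z_le_dec (Z.abs j0) (Z.of_nat n) then b else 0).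
{ induction n as [|n IH].
  - rewrite sum_O; unfold zfold; decide_Z; solve [exfalso; lia | reflexivity].
  - rewrite sum_Sn, IH; unfold zfold, plus; simpl plus.
    unfold plus; cbn -[Z.of_nat Z.le Z.eq_dec Z_le_dec]; decide_Z; try (exfalso; lia); lra. }
rewrite H; decide_Z; lra.
Qed.

Lemma window_band (u : Z -> R) (m : R) (i : Z) (L n : nat) :
  0 <= m -> (forall j, u j <= m) ->
  (forall j, (Z.abs (i - j) > Z.of_nat L)%Z -> u j = 0) ->
  sum_n (zfold u) n <= INR (2 * L + 1) * m.
Proof.
intros Hm Hu H0.
set (D := fun (p : nat) (j : Z) =>
  sum_n (fun k => if Z.eq_dec j (i - Z.of_nat L + Z.of_nat k)%Z then m else 0) p : R).
assert (DS : forall p j, D (S p) j =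
  D p j + if Z.eq_dec j (i - Z.of_nat L + Z.of_nat (S p))%Z then m else 0)
  by (intros; exact (sum_Sn _ _)).
assert (D0 : forall p j, 0 <= D p j).
{ intros p j; induction p as [|p IH]; [unfold D; rewrite sum_O|rewrite DS];
    decide_Z; lra. }
assert (D1 : forall p j, (exists k, (k <= p)%nat /\ j = (i - Z.of_nat L + Z.of_nat k)%Z) -> m <= D p j).
{ intros p j [k [Hk Hj]]; induction p as [|p IH].
  - unfold D; rewrite sum_O; decide_Z; [lra | exfalso; lia].
  - rewrite DS.
    destruct (Nat.eq_dec k (S p)) as [->|].
    + decide_Z; [generalize (D0 p j); lra | contradiction].
    + assert (m <= D p j) by (apply IH; lia).
      decide_Z; lra. }
assert (D2 : forall p, sum_n (zfold (D p)) n <= INR (S p) * m).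
{ induction p as [|p IH].
  - eapply Rle_trans; [|right; symmetry; apply Rmult_1_l].
    eapply Rle_trans; [|apply (window_dirac m (i - Z.of_nat L + Z.of_nat 0)%Z n Hm)].
    apply window_le; intros j; unfold D; rewrite sum_O; lra.
  - set (d := fun j => if Z.eq_dec j (i - Z.of_nat L + Z.of_nat (S p))%Z then m else 0).
    assert (T : sum_n (zfold d) n <= m) by (apply window_dirac, Hm).
    assert (E : sum_n (zfold (D (S p))) n = sum_n (zfold (D p)) n + sum_n (zfold d) n).
    { etransitivity; [|exact (sum_n_plus (zfold (D p)) (zfold d) n)].
      apply sum_n_ext; intros [|k]; unfold zfold; rewrite !DS; unfold plus; simpl.
      - reflexivity.
      - unfold d; simpl; ring. }
    rewrite E, (S_INR (S p)); lra. }
replace (2 * L + 1)%nat with (S (2 * L)) by lia.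
eapply Rle_trans; [|apply D2].
apply window_le; intros j.
destruct (Z_le_dec (Z.abs (i - j)) (Z.of_nat L)).
- eapply Rle_trans; [apply Hu|]; apply D1.
  exists (Z.to_nat (j - i + Z.of_nat L)); lia.
- rewrite H0 by lia; apply D0.
Qed.

Lemma act_bounded (X : Z -> Z -> C) (a : Z -> C) (L : nat) :
  finite_support X L -> isotropic X a ->
  exists B, 0 < B /\
    forall f, l2 f -> l2 (act X f) /\ l2norm (act X f) <= B * l2norm f.
Proof.
intros HL [HX _].
set (m := sum_n (zfold (fun l => Cmod (a l))) L).
assert (m0 : 0 <= m).
{ eapply Rle_trans; [apply (Cmod_ge_0 (a 0%Z))|].
  unfold m; clear; induction L as [|L IH]; [rewrite sum_O; simpl; lra|].
  rewrite sum_Sn; eapply Rle_trans; [exact IH|].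
  generalize (zfold_pos (fun l => Cmod (a l)) (S L) (fun l => Cmod_ge_0 (a l))).
  unfold plus; simpl AbelianMonoid.sort; simpl; lra. }
assert (am : forall l, Cmod (a l) <= m).
{ intros l; destruct (Z_le_dec (Z.abs l) (Z.of_nat L)) as [Hl|Hl].
  - eapply Rle_trans; [apply (window_term (fun l => Cmod (a l)) l); intros; apply Cmod_ge_0|].
    assert (Hn : (Z.abs_nat l <= L)%nat) by lia; clear - Hn; unfold m.
    induction Hn as [|n Hn IH]; [lra|].
    rewrite sum_Sn; eapply Rle_trans; [exact IH|].
    generalize (zfold_pos (fun l => Cmod (a l)) (S n) (fun l => Cmod_ge_0 (a l))).
    unfold plus; simpl; lra.
  - replace (a l) with (X l 0%Z) by (rewrite HX; f_equal; lia).
    rewrite HL by lia; rewrite Cmod_0; exact m0. }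
set (B := INR (2 * L + 1) * m + 1).
assert (HB : 0 < B) by (unfold B; assert (h := pos_INR (2 * L + 1)); nra).
exists (2 * B); split; [lra|].
apply act_bounded_schur; [exact HB| |].
- intros i n; apply Rle_trans with (INR (2 * L + 1) * m); [|unfold B; lra].
  apply (window_band _ m i L n m0); intros j; [rewrite HX; apply am|].
  intros Hj; rewrite HL by exact Hj; apply Cmod_0.
- intros j n; apply Rle_trans with (INR (2 * L + 1) * m); [|unfold B; lra].
  apply (window_band _ m j L n m0); intros i; [rewrite HX; apply am|].
  intros Hi; rewrite HL by lia; apply Cmod_0.
Qed.

(** The exponential series of a bounded operator converges to [op_exp] in
    operator norm. *)
Lemma op_exp_norm_limit (A : (Z -> C) -> (Z -> C)) (M : R) :
  0 < M ->
  (forall f, l2 f -> l2 (A f) /\ l2norm (A f) <= M * l2norm f) ->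
  forall eps, 0 < eps -> exists N0, forall N, (N0 <= N)%nat ->
  forall f, l2 f ->
    l2 (fun i => op_exp A f i - sum_n (op_exp_term A f i) N)%C /\
    l2norm (fun i => op_exp A f i - sum_n (op_exp_term A f i) N)%C <= eps * l2norm f.
Proof.
intros HM HA eps Heps.
set (c := fun n => / INR (fact n) * M ^ n).
assert (Fp : forall n, 0 < INR (fact n)) by (intros; apply INR_fact_lt_0).
assert (c0 : forall n, 0 < c n).
{ intros n; apply Rmult_lt_0_compat; [apply Rinv_0_lt_compat, Fp | now apply pow_lt]. }
assert (Ec : ex_series c).
{ exists (exp M); eapply is_series_ext; [|exact (is_exp_Reals M)].
  intros n; unfold c, scal; simpl; unfold mult; simpl.
  rewrite pow_n_pow; ring. }
assert (Et : forall N, ex_series (fun n => c (S N + n)%nat))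
  by (intros N; now apply (ex_series_incr_n c (S N))).
assert (T0 : forall N, Series (fun n => c (S N + n)%nat) = Series c - sum_n c N).
{ intros N; rewrite (Series_incr_n c (S N)) by (lia || exact Ec).
  rewrite <- sum_n_Reals; simpl pred; lra. }
assert (Lim : is_lim_seq (sum_n c) (Series c)) by exact (Series_correct c Ec).
apply is_lim_seq_spec in Lim.
destruct (Lim (mkposreal (eps / 2) ltac:(lra))) as [N0 HN0]; simpl in HN0.
exists N0; intros N HN f Hf.
assert (Hit : forall n, l2 (Nat.iter n A f) /\ l2norm (Nat.iter n A f) <= M ^ n * l2norm f).
{ induction n as [|n [I1 I2]]; [split; [exact Hf | simpl; lra]|].
  destruct (HA _ I1) as [J1 J2]; split; [exact J1|].
  change (Nat.iter (S n) A f) with (A (Nat.iter n A f)).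
  eapply Rle_trans; [exact J2|]; simpl; rewrite Rmult_assoc.
  apply Rmult_le_compat_l; lra. }
set (x := fun i n => Cmod (op_exp_term A f i n)).
assert (x0 : forall i n, 0 <= x i n) by (intros; apply Cmod_ge_0).
assert (Ex : forall i n, x i n = / INR (fact n) * Cmod (Nat.iter n A f i)).
{ intros i n; unfold x, op_exp_term, Cdiv; rewrite Cmod_mult, Cmod_inv, Cmod_R.
  - rewrite Rabs_pos_eq by (left; apply Fp); ring.
  - intros h; apply RtoC_inj in h; generalize (Fp n); lra. }
assert (nf : 0 <= l2norm f) by apply sqrt_pos.
assert (xc : forall i n, x i n <= c n * l2norm f).
{ intros i n; rewrite Ex; unfold c; rewrite Rmult_assoc.
  apply Rmult_le_compat_l; [left; apply Rinv_0_lt_compat, Fp|].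
  eapply Rle_trans; [apply Cmod_le_l2norm|]; apply Hit. }
set (T := Series (fun n => c (S N + n)%nat)).
assert (HTe : T <= eps / 2).
{ specialize (HN0 N HN); apply Rabs_def2 in HN0; unfold T; rewrite T0; lra. }
assert (HTp : 0 < T).
{ unfold T; eapply Rlt_le_trans; [apply (c0 (S N + 0)%nat)|].
  assert (P := partial_le_Series (fun n => c (S N + n)%nat) 0
    (fun n => Rlt_le _ _ (c0 _)) (Et N)); rewrite sum_O in P; exact P. }
assert (Exs : forall i, ex_series (x i)).
{ intros i; apply (ex_series_dom _ (fun n => l2norm f * c n)).
  - intros n; rewrite Rabs_pos_eq by apply x0; rewrite Rmult_comm; apply xc.
  - apply (ex_series_scal_l (l2norm f) _ Ec). }
assert (Tail : forall i, (op_exp A f i - sum_n (op_exp_term A f i) N)%C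
                         = CSeries (fun n => op_exp_term A f i (S N + n)%nat)).
{ intros i; unfold op_exp, CSeries.
  assert (Ere : ex_series (fun n => Re (op_exp_term A f i n))).
  { apply (ex_series_dom _ (x i)); [|apply Exs]; intros n.
    eapply Rle_trans; [apply Rmax_l | apply Rmax_Cmod]. }
  assert (Eim : ex_series (fun n => Im (op_exp_term A f i n))).
  { apply (ex_series_dom _ (x i)); [|apply Exs]; intros n.
    eapply Rle_trans; [apply Rmax_r | apply Rmax_Cmod]. }
  rewrite (Series_incr_n (fun n => Re _) (S N)) by (lia || exact Ere).
  rewrite (Series_incr_n (fun n => Im _) (S N)) by (lia || exact Eim).
  rewrite <- !sum_n_Reals; simpl pred.
  rewrite <- (sum_n_Cre (op_exp_term A f i)), <- (sum_n_Cim (op_exp_term A f i)).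
  destruct (sum_n (op_exp_term A f i) N) as [u v]; simpl.
  unfold Cminus, Cplus, Copp; simpl; f_equal; ring. }
set (q := fun i n => / c (S N + n)%nat * x i (S N + n)%nat ^ 2).
assert (q0 : forall i n, 0 <= q i n).
{ intros; apply Rmult_le_pos; [left; apply Rinv_0_lt_compat, c0 | apply sq_pos]. }
assert (Eq : forall i, ex_series (q i)).
{ intros i; apply (ex_series_dom _ (fun n => l2norm f ^ 2 * c (S N + n)%nat)).
  - intros n; rewrite Rabs_pos_eq by apply q0; unfold q.
    generalize (c0 (S N + n)%nat) (x0 i (S N + n)%nat) (xc i (S N + n)%nat).
    generalize (c (S N + n)%nat) (x i (S N + n)%nat); intros cc xx h1 h2 h3.
    apply (Rmult_le_reg_l cc); [exact h1|].
    rewrite <- Rmult_assoc, Rinv_r, Rmult_1_l by lra.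
    replace (cc * (l2norm f ^ 2 * cc)) with ((cc * l2norm f) ^ 2) by ring.
    apply pow_incr; lra.
  - apply (ex_series_scal_l (l2norm f ^ 2) _ (Et N)). }
assert (Pt : forall i, Cmod (op_exp A f i - sum_n (op_exp_term A f i) N)%C ^ 2
                       <= 4 * T * Series (q i)).
{ intros i; rewrite Tail.
  destruct (weighted_cauchy_schwarz (fun n => c (S N + n)%nat) (q i)
              (fun n => x i (S N + n)%nat) T) as [E1 S1]; auto.
  - intros n; left; apply c0.
  - intros n; unfold q; right; field; apply Rgt_not_eq, c0.
  - unfold T; lra.
  - assert (Q := Cmod_CSeries_le (fun n => op_exp_term A f i (S N + n)%nat)
                   (fun n => x i (S N + n)%nat) (fun n => Rle_refl _) E1).
    generalize (Cmod_ge_0 (CSeries (fun n => op_exp_term A f i (S N + n)%nat))); nra. }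
destruct (l2_of_windows (fun i => op_exp A f i - sum_n (op_exp_term A f i) N)%C
            (2 * T * l2norm f)) as [R1 R2].
{ apply Rmult_le_pos; lra. }
{ intros n; eapply Rle_trans; [apply window_le, Pt|].
  rewrite window_scal; destruct (window_Series q n Eq) as [E1 ->].
  assert (S1 : Series (fun m => sum_n (zfold (fun i => q i m)) n) <= l2norm f ^ 2 * T).
  { unfold T; rewrite <- Series_scal_l; apply Series_le.
    - intros m; split.
      + rewrite <- (Rmult_0_l (sum_n (zfold (fun i => 0)) n)), <- window_scal.
        apply window_le; intros i; rewrite Rmult_0_l; apply q0.
      + set (k := (S N + m)%nat).
        eapply Rle_trans.
        * apply (window_le _ (fun i => / c k * (/ INR (fact k)) ^ 2
                                       * Cmod (Nat.iter k A f i) ^ 2)).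
          intros i; unfold q; fold k; rewrite Ex; right; ring.
        * rewrite window_scal.
          destruct (Hit k) as [I1 I2].
          assert (W := window_le_l2norm _ n I1).
          assert (I3 : l2norm (Nat.iter k A f) ^ 2 <= (M ^ k * l2norm f) ^ 2)
            by (apply pow_incr; split; [apply sqrt_pos | exact I2]).
          assert (ck := c0 k); assert (fk := Fp k).
          assert (G : 0 <= / c k * (/ INR (fact k)) ^ 2).
          { apply Rmult_le_pos; [left; now apply Rinv_0_lt_compat | apply sq_pos]. }
          eapply Rle_trans; [apply Rmult_le_compat_l; [exact G | eapply Rle_trans; [exact W | exact I3]]|].
          right; unfold c; field; split; [lra | apply pow_nonzero; lra].
    - apply (ex_series_scal_l (l2norm f ^ 2) _ (Et N)). }
  apply (Rmult_le_compat_l (4 * T)) in S1; [|lra].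
  eapply Rle_trans; [exact S1|]; right; ring. }
split; [exact R1|].
eapply Rle_trans; [exact R2|]; apply Rmult_le_compat_r; lra.
Qed.

Lemma evolution_norm_limit (X : Z -> Z -> C) (a : Z -> C) (L : nat) (t : R) :
  finite_support X L -> isotropic X a ->
  forall eps, 0 < eps -> exists N0, forall N, (N0 <= N)%nat ->
  forall f, l2 f ->
    let r := fun i => (evolution X t f i
      - sum_n (op_exp_term (fun g i => Ci * RtoC t * act X g i) f i) N)%C in
    l2 r /\ l2norm r <= eps * l2norm f.
Proof.
intros HL Ha eps Heps.
destruct (act_bounded X a L HL Ha) as [B [HB HX]].
apply (op_exp_norm_limit _ ((Rabs t + 1) * B)); [|clear eps Heps|exact Heps].
{ apply Rmult_lt_0_compat; [generalize (Rabs_pos t); lra | exact HB]. }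
intros f Hf; destruct (HX f Hf) as [H1 H2].
assert (nf : 0 <= l2norm f) by apply sqrt_pos.
assert (na : 0 <= l2norm (act X f)) by apply sqrt_pos.
assert (tp := Rabs_pos t).
assert (P : forall i, Cmod (Ci * RtoC t * act X f i)%C ^ 2 = t ^ 2 * Cmod (act X f i) ^ 2).
{ intros i; rewrite !Cmod_mult, Cmod_R, <- (pow2_abs t).
  assert (Cmod Ci = 1) as -> by (etransitivity; [|exact sqrt_1]; unfold Cmod, Ci; f_equal; simpl; ring).
  ring. }
destruct (l2_of_windows (fun i => Ci * RtoC t * act X f i)%C (Rabs t * l2norm (act X f)))
  as [R1 R2].
{ now apply Rmult_le_pos. }
{ intros n; eapply Rle_trans; [apply window_le; intros i; right; apply P|].
  rewrite window_scal, Rpow_mult_distr, pow2_abs.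
  apply Rmult_le_compat_l; [apply sq_pos | now apply window_le_l2norm]. }
split; [exact R1|].
eapply Rle_trans; [exact R2|].
assert (Rabs t * l2norm (act X f) <= Rabs t * (B * l2norm f)) by now apply Rmult_le_compat_l.
assert (0 <= B * l2norm f) by (apply Rmult_le_pos; lra).
rewrite Rmult_assoc; nra.
Qed.

(* Main.v *)
Require Import Defs.
From Stdlib Require Import Reals ZArith Lra Lia List Permutation Arith.
From Coquelicot Require Import Coquelicot.
Local Open Scope R_scope.

(** In the Fourier picture the walk operator is multiplication by the real trigonometric
    polynomial [P], so the return amplitude is
    [psi0 (t) = (1 / 2 PI) int exp (i t P (x)) dx] over a period ([psi0_integral]).

    Stationary phase ([stationary_phase]) evaluates this integral with error [O (1 / t)]:
    each critical point [c] contributes a wave of amplitude [sqrt (2 PI / (|P''(c)| t))]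
    and frequency [P(c)], up to a constant phase.  Near [c] one has [P - P(c) = +- u^2]
    for a smooth coordinate [u], and the key identity [1 = const * u' + w P'] of
    [critical_normal_form], with [w] continuously differentiable, splits the integral in
    two.  The first part is a Fresnel integral after the substitution [v = u(x)].  The
    second is [O (1 / t)] by a single integration by parts ([oscillatory_by_parts]), and
    so is everything away from the critical points, where [1 = (1 / P') P'].  Of the
    Fresnel integral only the modulus enters, and it is found by differentiating the
    square of the partial integrals ([fresnel_limit]).

    In [|psi0|^2] the diagonal terms add up to
    [(1 / (2 PI s)) sum 1 / |P''(theta k)|], the errors are [O (s^(-3/2))], and the
    interference terms oscillate like [cos (s (P(theta j) - P(theta k)) + const) / s]
    with nonzero frequencies because the critical values are distinct.  Over a window
    of length [sqrt t] such a term integrates to [O (1 / t)], hence averages to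
    [O (t^(-3/2))], while the average of [1 / s] is [1 / t + O (t^(-3/2))]
    ([window_energy]).

    Complex exponentials are handled throughout as [cos (s P + phi)] with estimates
    uniform in the shift [phi]. *)

(** * Integrals of continuous real functions *)

(** The type of an equation between integrals or sums is a projection of an algebraic
    structure; the arithmetic tactics want to see [R] itself. *)
Ltac toR := match goal with |- @eq _ ?x ?y => change (@eq R x y) end.

Lemma RInt_ext_R (f g : R -> R) a b :
  (forall x, Rmin a b < x < Rmax a b -> f x = g x) -> RInt f a b = RInt g a b.
Proof. exact (RInt_ext (V := R_CompleteNormedModule) f g a b). Qed.

Lemma is_derive_continuous (f : R -> R) (x l : R) : is_derive f x l -> continuous f x.
Proof. intros H; apply (ex_derive_continuous (V := R_NormedModule) f x); now exists l. Qed.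

Lemma continuity_pt_of_continuous (f : R -> R) x : continuous f x -> continuity_pt f x.
Proof. intros H; apply continuity_pt_filterlim, H. Qed.

Ltac cont_derive :=
  match goal with |- continuous ?f ?x =>
    apply (ex_derive_continuous (V := R_NormedModule) f x); auto_derive; auto end.

Lemma ex_RInt_on (f : R -> R) a b :
  a <= b -> (forall x, a <= x <= b -> continuous f x) -> ex_RInt f a b.
Proof.
intros Hab H; apply (ex_RInt_continuous (V := R_CompleteNormedModule)).
intros z; rewrite Rmin_left, Rmax_right by lra; apply H.
Qed.

Lemma ex_RInt_everywhere (f : R -> R) a b : (forall x, continuous f x) -> ex_RInt f a b.
Proof. intros H; apply (ex_RInt_continuous (V := R_CompleteNormedModule)); intros; apply H. Qed.

Lemma RInt_lin2 (f g : R -> R) k l a b :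
  ex_RInt f a b -> ex_RInt g a b ->
  RInt (fun x => k * f x + l * g x) a b = k * RInt f a b + l * RInt g a b.
Proof.
intros Hf Hg.
apply (is_RInt_unique (V := R_CompleteNormedModule)).
apply (is_RInt_plus (V := R_NormedModule) (fun x => k * f x) (fun x => l * g x));
[apply (is_RInt_scal (V := R_NormedModule) f)|apply (is_RInt_scal (V := R_NormedModule) g)];
now apply (RInt_correct (V := R_CompleteNormedModule)).
Qed.

Lemma RInt_scal_R (f : R -> R) k a b :
  ex_RInt f a b -> RInt (fun x => k * f x) a b = k * RInt f a b.
Proof. exact (RInt_scal (V := R_CompleteNormedModule) f a b k). Qed.

Lemma RInt_Chasles_minus (f : R -> R) a b c :
  (forall x, continuous f x) -> RInt f a c - RInt f a b = RInt f b c.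
Proof.
intros H.
rewrite <- (RInt_Chasles (V := R_CompleteNormedModule) f a b c) by now apply ex_RInt_everywhere.
unfold plus; simpl; ring.
Qed.

Lemma RInt_dominated (f g : R -> R) a b :
  a <= b -> ex_RInt f a b -> ex_RInt g a b ->
  (forall x, a <= x <= b -> Rabs (f x) <= g x) -> Rabs (RInt f a b) <= RInt g a b.
Proof.
intros Hab Hf Hg H.
apply Rabs_le; split.
- rewrite <- (Ropp_involutive (RInt f a b)); apply Ropp_le_contravar.
  rewrite <- (RInt_opp (V := R_CompleteNormedModule) f) by exact Hf.
  apply RInt_le; auto.
  + now apply (ex_RInt_opp (V := R_NormedModule)).
  + intros x Hx; assert (Q := H x ltac:(lra)); apply Rabs_le_between in Q.
    unfold opp; simpl; lra.
- apply RInt_le; auto.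
  intros x Hx; assert (Q := H x ltac:(lra)); apply Rabs_le_between in Q; lra.
Qed.

Lemma continuous_cos_comp (f : R -> R) x : continuous f x -> continuous (fun y => cos (f y)) x.
Proof. intros H; apply continuous_comp; [exact H|apply continuous_cos]. Qed.

Lemma continuous_sin_comp (f : R -> R) x : continuous f x -> continuous (fun y => sin (f y)) x.
Proof. intros H; apply continuous_comp; [exact H|apply continuous_sin]. Qed.

Lemma continuous_affine (p : R -> R) s phi x :
  continuous p x -> continuous (fun y => s * p y + phi) x.
Proof.
intros H; apply (continuous_plus (fun y => s * p y) (fun _ => phi)).
- apply (continuous_scal_r s p x H).
- apply continuous_const.
Qed.

Lemma Rabs_sin_le x : Rabs (sin x) <= 1.
Proof. apply Rabs_le; generalize (SIN_bound x); lra. Qed.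

Lemma Rabs_cos_le x : Rabs (cos x) <= 1.
Proof. apply Rabs_le; generalize (COS_bound x); lra. Qed.

Lemma is_derive_RInt_param_global (f df : R -> R -> R) a b x :
  (forall u v, is_derive (fun z => f z v) u (df u v)) ->
  (forall u v, continuity_2d_pt df u v) ->
  (forall u v, continuous (f u) v) ->
  is_derive (fun u => RInt (f u) a b) x (RInt (df x) a b).
Proof.
intros D C2 C1.
assert (E : forall u v, Derive (fun z => f z v) u = df u v)
  by (intros; now apply is_derive_unique).
rewrite (RInt_ext_R (df x) (fun v => Derive (fun z => f z v) x)) by (intros; now rewrite E).
apply (is_derive_RInt_param f a b x).
- exists (mkposreal 1 Rlt_0_1); intros y _ t _; now exists (df y t).
- intros t _; apply (continuity_2d_pt_ext df); [intros; now rewrite E|apply C2].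
- exists (mkposreal 1 Rlt_0_1); intros y _; apply (ex_RInt_continuous (V := R_CompleteNormedModule)).
  intros; apply C1.
Qed.

Ltac cont2d :=
  repeat match goal with
  | |- continuity_2d_pt (fun u v => u) _ _ => apply continuity_2d_pt_id1
  | |- continuity_2d_pt (fun u v => v) _ _ => apply continuity_2d_pt_id2
  | |- continuity_2d_pt (fun u v => ?c) _ _ => apply continuity_2d_pt_const
  | |- continuity_2d_pt (fun u v => _ + _) _ _ => apply continuity_2d_pt_plus
  | |- continuity_2d_pt (fun u v => _ * _) _ _ => apply continuity_2d_pt_mult
  | |- continuity_2d_pt (fun u v => cos _) _ _ =>
      apply (continuity_1d_2d_pt_comp cos); [apply continuity_pt_of_continuous, continuous_cos|]
  | |- continuity_2d_pt (fun u v => sin _) _ _ =>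
      apply (continuity_1d_2d_pt_comp sin); [apply continuity_pt_of_continuous, continuous_sin|]
  end.

(** * Oscillatory integrals *)

(** Since [f'] is an explicit function, its continuity at the end points makes sense
    without one-sided limits or any smoothness of [f] beyond them. *)
Definition C1_on (a b : R) (f f' : R -> R) : Prop :=
  forall x, a <= x <= b -> is_derive f x (f' x) /\ continuous f' x.

Lemma C1_on_plus a b f f' g g' :
  C1_on a b f f' -> C1_on a b g g' ->
  C1_on a b (fun x => f x + g x) (fun x => f' x + g' x).
Proof.
intros Hf Hg x Hx; destruct (Hf x Hx) as [F1 F2]; destruct (Hg x Hx) as [G1 G2]; split.
- exact (is_derive_plus f g x _ _ F1 G1).
- exact (continuous_plus f' g' x F2 G2).
Qed.

Lemma C1_on_mult a b f f' g g' :
  C1_on a b f f' -> C1_on a b g g' ->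
  C1_on a b (fun x => f x * g x) (fun x => f' x * g x + f x * g' x).
Proof.
intros Hf Hg x Hx; destruct (Hf x Hx) as [F1 F2]; destruct (Hg x Hx) as [G1 G2]; split.
- exact (is_derive_mult f g x _ _ F1 G1 Rmult_comm).
- apply (continuous_plus (fun x => f' x * g x) (fun x => f x * g' x));
  [apply (continuous_mult f' g) | apply (continuous_mult f g')]; auto;
  eapply is_derive_continuous; eauto.
Qed.

Lemma C1_on_scal a b k f f' :
  C1_on a b f f' -> C1_on a b (fun x => k * f x) (fun x => k * f' x).
Proof.
intros Hf x Hx; destruct (Hf x Hx) as [F1 F2]; split.
- now apply is_derive_scal.
- apply (continuous_scal_r k f' x F2).
Qed.

Lemma C1_on_comp a b f f' g g' :
  (forall x, a <= x <= b -> is_derive g (f x) (g' (f x)) /\ continuous g' (f x)) ->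
  C1_on a b f f' -> C1_on a b (fun x => g (f x)) (fun x => f' x * g' (f x)).
Proof.
intros Hg Hf x Hx; destruct (Hf x Hx) as [F1 F2]; destruct (Hg x Hx) as [G1 G2]; split.
- exact (is_derive_comp g f x _ _ G1 F1).
- apply (continuous_mult f' (fun x => g' (f x))); auto.
  apply continuous_comp; auto; eapply is_derive_continuous; eauto.
Qed.

Lemma C1_on_inv a b f f' :
  (forall x, a <= x <= b -> f x <> 0) -> C1_on a b f f' ->
  exists g', C1_on a b (fun x => / f x) g'.
Proof.
intros H0 Hf; eexists; refine (C1_on_comp a b f f' Rinv (fun y => - / y ^ 2) _ Hf).
intros x Hx; specialize (H0 x Hx); split.
- auto_derive; [exact H0|simpl; field; exact H0].
- apply (ex_derive_continuous (V := R_NormedModule) (fun y => - / y ^ 2)); auto_derive.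
  simpl; nra.
Qed.

Lemma C1_on_sqrt a b f f' :
  (forall x, a <= x <= b -> 0 < f x) -> C1_on a b f f' ->
  C1_on a b (fun x => sqrt (f x)) (fun x => f' x * / (2 * sqrt (f x))).
Proof.
intros H0 Hf; apply (C1_on_comp a b f f' sqrt (fun y => / (2 * sqrt y))); [|exact Hf].
intros x Hx; specialize (H0 x Hx).
assert (S := sqrt_lt_R0 _ H0); split.
- auto_derive; [exact H0|field; lra].
- apply (ex_derive_continuous (V := R_NormedModule) (fun y => / (2 * sqrt y))); auto_derive.
  split; [exact H0|split; [lra|trivial]].
Qed.

Lemma C1_on_cont a b f f' x : C1_on a b f f' -> a <= x <= b -> continuous f x.
Proof. intros H Hx; eapply is_derive_continuous; apply H, Hx. Qed.

(** An integrand divisible by the derivative of the phase gains a factor [1 / s]: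
    [w p' cos (s p + phi)] is [1 / s] times [(w sin (s p + phi))' - w' sin (s p + phi)].
    The free shift [phi] stands for complex exponentials: [phi = 0] is the real part
    and [phi = - PI / 2] the imaginary part of [exp (i s p)]. *)
Lemma oscillatory_by_parts a b w w' p p' s phi :
  a <= b -> 0 < s -> C1_on a b w w' -> C1_on a b p p' ->
  Rabs (RInt (fun x => w x * p' x * cos (s * p x + phi)) a b)
  <= (Rabs (w a) + Rabs (w b) + RInt (fun x => Rabs (w' x)) a b) / s.
Proof.
intros Hab Hs Hw Hp.
assert (Cw : forall x, a <= x <= b -> continuous w x) by (intros; eapply C1_on_cont; eauto).
assert (Cp : forall x, a <= x <= b -> continuous p x) by (intros; eapply C1_on_cont; eauto).
set (f1 := fun x => w' x * sin (s * p x + phi)).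
set (f2 := fun x => w x * p' x * cos (s * p x + phi)).
assert (C1 : forall x, a <= x <= b -> continuous f1 x).
{ intros x Hx; apply (continuous_mult w'); [apply Hw, Hx|].
  apply continuous_sin_comp, continuous_affine, Cp, Hx. }
assert (C2 : forall x, a <= x <= b -> continuous f2 x).
{ intros x Hx; apply (continuous_mult (fun x => w x * p' x)).
  - apply (continuous_mult w p'); [apply Cw, Hx|apply Hp, Hx].
  - apply continuous_cos_comp, continuous_affine, Cp, Hx. }
assert (E1 := ex_RInt_on f1 a b Hab C1); assert (E2 := ex_RInt_on f2 a b Hab C2).
assert (I : is_RInt (fun x => f1 x + s * f2 x) a b
   (w b * sin (s * p b + phi) - w a * sin (s * p a + phi))).
{ apply (is_RInt_derive (V := R_CompleteNormedModule) (fun x => w x * sin (s * p x + phi)));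
  intros x; rewrite Rmin_left, Rmax_right by lra; intros Hx.
  - destruct (Hw x Hx) as [W1 _]; destruct (Hp x Hx) as [P1 _].
    assert (P2 := is_derive_unique _ _ _ P1); assert (W2 := is_derive_unique _ _ _ W1).
    auto_derive; [split; [now exists (w' x)|split; [now exists (p' x)|trivial]]|].
    change (Derive (fun x => p x) x) with (Derive p x);
    change (Derive (fun x => w x) x) with (Derive w x).
    rewrite P2, W2; unfold f1, f2; ring.
  - apply (continuous_plus f1 (fun x => s * f2 x)); [apply C1, Hx|].
    apply (continuous_scal_r s f2); apply C2, Hx. }
apply (is_RInt_unique (V := R_CompleteNormedModule)) in I.
assert (J : RInt (fun x => f1 x + s * f2 x) a b = RInt f1 a b + s * RInt f2 a b).
{ etransitivity; [apply (RInt_plus (V := R_CompleteNormedModule) f1 (fun x => s * f2 x));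
   [exact E1|apply (ex_RInt_scal (V := R_NormedModule) f2); exact E2]|].
  change (RInt f1 a b + RInt (fun x => scal s (f2 x)) a b = RInt f1 a b + s * RInt f2 a b).
  rewrite (RInt_scal (V := R_CompleteNormedModule) f2) by exact E2; reflexivity. }
assert (D : Rabs (RInt f1 a b) <= RInt (fun x => Rabs (w' x)) a b).
{ apply RInt_dominated; auto.
  - apply ex_RInt_on; auto; intros x Hx; apply continuous_comp; [apply Hw, Hx|].
    apply continuous_Rabs.
  - intros x Hx; unfold f1; rewrite Rabs_mult.
    generalize (Rabs_sin_le (s * p x + phi)) (Rabs_pos (w' x)); nra. }
change (Rabs (RInt f2 a b) <= (Rabs (w a) + Rabs (w b) + RInt (fun x => Rabs (w' x)) a b) / s).
assert (B : forall u v, Rabs (u * sin v) <= Rabs u).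
{ intros u v; rewrite Rabs_mult; generalize (Rabs_sin_le v) (Rabs_pos u); nra. }
apply (Rmult_le_reg_l s); [exact Hs|].
replace (s * _) with (Rabs (s * RInt f2 a b)) by (rewrite Rabs_mult, (Rabs_pos_eq s); lra).
replace (s * (_ / s)) with (Rabs (w a) + Rabs (w b) + RInt (fun x => Rabs (w' x)) a b) by (field; lra).
replace (s * RInt f2 a b) with (w b * sin (s * p b + phi) + - (w a * sin (s * p a + phi)) + - RInt f1 a b) by lra.
eapply Rle_trans; [apply Rabs_triang|]; rewrite Rabs_Ropp.
eapply Rle_trans; [apply Rplus_le_compat_r, Rabs_triang|]; rewrite Rabs_Ropp.
generalize (B (w a) (s * p a + phi)) (B (w b) (s * p b + phi)); lra.
Qed.

(** The form used for fixed amplitude and phase: the bound is uniform in the shift. *)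
Lemma oscillatory_bound a b w w' p p' :
  a <= b -> C1_on a b w w' -> C1_on a b p p' ->
  exists M, 0 <= M /\ forall s phi, 0 < s ->
  Rabs (RInt (fun x => w x * p' x * cos (s * p x + phi)) a b) <= M / s.
Proof.
intros Hab Hw Hp.
exists (Rabs (w a) + Rabs (w b) + RInt (fun x => Rabs (w' x)) a b); split.
- assert (0 <= RInt (fun x => Rabs (w' x)) a b).
  { apply RInt_ge_0; auto.
    - apply ex_RInt_on; auto; intros x Hx; apply continuous_comp; [apply Hw, Hx|].
      apply continuous_Rabs.
    - intros; apply Rabs_pos. }
  generalize (Rabs_pos (w a)) (Rabs_pos (w b)); lra.
- intros s phi Hs; now apply oscillatory_by_parts.
Qed.

(** For the amplitude [k / x] the variation is computed exactly, which makes the bound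
    independent of the right end point.  This controls both the tail of the Fresnel
    integral ([p = x^2]) and the window averages of nonresonant terms ([p] linear). *)
Lemma oscillatory_reciprocal a b k p p' phi :
  0 < a <= b -> C1_on a b p p' ->
  Rabs (RInt (fun x => k / x * p' x * cos (p x + phi)) a b) <= 2 * Rabs k / a.
Proof.
intros Hab Hp.
assert (W : C1_on a b (fun x => k / x) (fun x => - k / x ^ 2)).
{ intros x Hx; split.
  - auto_derive; [lra|field; lra].
  - apply (ex_derive_continuous (V := R_NormedModule) (fun x => - k / x ^ 2)); auto_derive; simpl; nra. }
assert (H := oscillatory_by_parts a b _ _ p p' 1 phi ltac:(lra) ltac:(lra) W Hp).
erewrite RInt_ext; [|intros x Hx; rewrite <- (Rmult_1_l (p x)); reflexivity].
cbv beta in H; eapply Rle_trans; [exact H|].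
assert (I : is_RInt (fun x => Rabs (- k / x ^ 2)) a b (- Rabs k / b - - Rabs k / a)).
{ apply (is_RInt_ext (fun x => Rabs k / x ^ 2)).
  - intros x; rewrite Rmin_left, Rmax_right by lra; intros Hx.
    unfold Rdiv; rewrite Rabs_mult, Rabs_Ropp, Rabs_inv, (Rabs_pos_eq (x ^ 2)); [reflexivity|].
    apply pow2_ge_0.
  - apply (is_RInt_derive (V := R_CompleteNormedModule) (fun x => - Rabs k / x));
    intros x; rewrite Rmin_left, Rmax_right by lra; intros Hx.
    + auto_derive; [lra|field; lra].
    + apply (ex_derive_continuous (V := R_NormedModule) (fun x => Rabs k / x ^ 2)); auto_derive; simpl; nra. }
apply (is_RInt_unique (V := R_CompleteNormedModule)) in I; rewrite I.
unfold Rdiv; rewrite !Rabs_mult, !Rabs_inv, (Rabs_pos_eq a), (Rabs_pos_eq b) by lra.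
right; field; lra.
Qed.

(** * The Fresnel integral *)

Definition FresnelC (T : R) : R := RInt (fun v => cos (v * v)) 0 T.
Definition FresnelS (T : R) : R := RInt (fun v => sin (v * v)) 0 T.

Lemma FresnelC_derive T : is_derive FresnelC T (cos (T * T)).
Proof.
apply (is_derive_RInt (V := R_NormedModule) (fun v => cos (v * v)) FresnelC 0 T).
- exists (mkposreal 1 Rlt_0_1); intros y _; apply (RInt_correct (V := R_CompleteNormedModule)).
  apply ex_RInt_everywhere; intros; cont_derive.
- cont_derive.
Qed.

Lemma FresnelS_derive T : is_derive FresnelS T (sin (T * T)).
Proof.
apply (is_derive_RInt (V := R_NormedModule) (fun v => sin (v * v)) FresnelS 0 T).
- exists (mkposreal 1 Rlt_0_1); intros y _; apply (RInt_correct (V := R_CompleteNormedModule)).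
  apply ex_RInt_everywhere; intros; cont_derive.
- cont_derive.
Qed.

Lemma fresnel_phase T phi :
  RInt (fun v => cos (v * v + phi)) 0 T = FresnelC T * cos phi - FresnelS T * sin phi.
Proof.
rewrite (RInt_ext_R _ (fun v => cos phi * cos (v * v) + (- sin phi) * sin (v * v)))
  by (intros; rewrite cos_plus; ring).
rewrite RInt_lin2 by (apply ex_RInt_everywhere; intros; cont_derive).
unfold FresnelC, FresnelS; toR; ring.
Qed.

Lemma fresnel_scale T u phi :
  u * RInt (fun x => cos ((u * x) * (u * x) + phi)) 0 T
  = FresnelC (u * T) * cos phi - FresnelS (u * T) * sin phi.
Proof.
rewrite <- fresnel_phase.
assert (H := RInt_comp_lin (V := R_CompleteNormedModule) (fun v => cos (v * v + phi)) u 0 0 T).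
assert (E : forall x, ex_RInt (fun v => cos (v * v + phi)) 0 x)
 by (intros; apply ex_RInt_everywhere; intros; cont_derive).
replace (u * 0 + 0) with 0 in H by ring; replace (u * T + 0) with (u * T) in H by ring.
rewrite <- H by apply E.
rewrite <- (RInt_scal_R (fun x => cos (u * x * (u * x) + phi)))
  by (apply ex_RInt_everywhere; intros; cont_derive).
apply RInt_ext_R; intros; now rewrite Rplus_0_r.
Qed.

Lemma fresnel_tail a b phi : 0 < a <= b ->
  Rabs (RInt (fun v => cos (v * v + phi)) a b) <= 1 / a.
Proof.
intros Hab.
assert (P : C1_on a b (fun x => x * x) (fun x => 2 * x)).
{ intros x _; split; [auto_derive; [trivial|ring]|cont_derive]. }
assert (H := oscillatory_reciprocal a b (1 / 2) _ _ phi Hab P); cbv beta in H.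
rewrite (RInt_ext_R _ (fun v => cos (v * v + phi))) in H.
- eapply Rle_trans; [exact H|]; rewrite Rabs_pos_eq by lra; right; field; lra.
- intros x; rewrite Rmin_left, Rmax_right by lra; intros Hx; field; lra.
Qed.

Lemma limit_of_reciprocal_cauchy (f : R -> R) k :
  (forall a b, 0 < a <= b -> Rabs (f b - f a) <= k / a) ->
  exists l, forall a, 0 < a -> Rabs (f a - l) <= k / a.
Proof.
intros H.
assert (K : 0 <= k).
{ generalize (H 1 1 ltac:(lra)) (Rabs_pos (f 1 - f 1)); lra. }
set (u := fun n => f (INR n + 1)).
assert (Pn : forall n, 0 < INR n + 1) by (intros n; generalize (pos_INR n); lra).
assert (E : ex_finite_lim_seq u).
{ apply ex_lim_seq_cauchy_corr; intros eps.
  destruct (archimed_cor1 (eps / (2 * (k + 1)))) as [N [HN HN0]].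
  { apply Rdiv_lt_0_compat; [apply cond_pos|lra]. }
  assert (Q : forall n, (N <= n)%nat -> Rabs (u n - u N) < eps / 2).
  { intros n Hn; eapply Rle_lt_trans; [apply H|].
    - split; [apply Pn|]; apply le_INR in Hn; lra.
    - apply Rle_lt_trans with (k * / INR N).
      + apply Rmult_le_compat_l; [exact K|]; apply Rinv_le_contravar; [|lra].
        now apply lt_0_INR.
      + apply Rle_lt_trans with ((k + 1) * / INR N).
        * apply Rmult_le_compat_r; [|lra]; left; apply Rinv_0_lt_compat; now apply lt_0_INR.
        * apply (Rmult_lt_compat_l (k + 1)) in HN; [|lra].
          replace (eps / 2) with ((k + 1) * (eps / (2 * (k + 1)))) by (field; lra); exact HN. }
  exists N; intros n m Hn Hm.
  replace (u n - u m) with ((u n - u N) - (u m - u N)) by ring.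
  eapply Rle_lt_trans; [apply Rabs_triang|]; rewrite Rabs_Ropp.
  generalize (Q n Hn) (Q m Hm); lra. }
destruct E as [l Hl]; exists l; intros a Ha.
assert (L : is_lim_seq (fun n => Rabs (f a - u n)) (Rabs (f a - l))).
{ apply (is_lim_seq_abs _ (f a - l)).
  apply is_lim_seq_minus'; [apply is_lim_seq_const|exact Hl]. }
assert (Rbar_le (Rabs (f a - l)) (k / a)); [|assumption].
apply (is_lim_seq_le_loc (fun n => Rabs (f a - u n)) (fun _ => k / a));
  [|exact L|apply is_lim_seq_const].
destruct (nfloor_ex a ltac:(lra)) as [N HN].
exists N; intros n Hn; rewrite Rabs_minus_sym; apply H; split; [exact Ha|].
apply le_INR in Hn; lra.
Qed.

Lemma fresnel_converges : exists c d, forall T, 0 < T ->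
  Rabs (FresnelC T - c) <= 1 / T /\ Rabs (FresnelS T - d) <= 1 / T.
Proof.
destruct (limit_of_reciprocal_cauchy FresnelC 1) as [c Hc].
{ intros a b Hab; unfold FresnelC; rewrite RInt_Chasles_minus by (intros; cont_derive).
  erewrite RInt_ext_R; [apply (fresnel_tail a b 0 Hab)|intros; simpl; now rewrite Rplus_0_r]. }
destruct (limit_of_reciprocal_cauchy FresnelS 1) as [d Hd].
{ intros a b Hab; unfold FresnelS; rewrite RInt_Chasles_minus by (intros; cont_derive).
  erewrite RInt_ext_R; [apply (fresnel_tail a b (- (PI / 2)) Hab)|intros; simpl].
  rewrite <- (cos_shift (x * x)), <- cos_neg; f_equal; ring. }
exists c, d; intros T HT; split; [now apply Hc|now apply Hd].
Qed.

(** For [I(T) = int_0^T exp (i v^2) dv], the derivative of [I^2] is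
    [2 int_0^T exp (i (T^2 + v^2)) dv]; substituting [v = T x] shows that it is also the
    derivative of [- i int_0^1 exp (i T^2 (1 + x^2)) / (1 + x^2) dx].  [FresnelG phi] is
    the real part of this last function multiplied by [exp (i phi)]. *)
Definition FresnelG (phi T : R) : R :=
  RInt (fun x => sin (T * T * (1 + x * x) + phi) / (1 + x * x)) 0 1.

Lemma one_plus_sq (x : R) : 1 + x * x <> 0.
Proof. generalize (Rle_0_sqr x); unfold Rsqr; lra. Qed.

Lemma FresnelG_derive phi T :
  is_derive (FresnelG phi) T
    (2 * (FresnelC T * cos (T * T + phi) - FresnelS T * sin (T * T + phi))).
Proof.
assert (D : is_derive (FresnelG phi) T
   (RInt ((fun u x => 2 * u * cos (u * u * (1 + x * x) + phi)) T) 0 1)).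
{ apply (is_derive_RInt_param_global
    (fun u x => sin (u * u * (1 + x * x) + phi) / (1 + x * x))
    (fun u x => 2 * u * cos (u * u * (1 + x * x) + phi)) 0 1 T).
  - intros u v; assert (h := one_plus_sq v); auto_derive; [trivial|simpl; field; exact h].
  - intros u v; cont2d.
  - intros u v; assert (h := one_plus_sq v); cont_derive. }
replace (2 * (FresnelC T * cos (T * T + phi) - FresnelS T * sin (T * T + phi)))
 with (RInt (fun x => 2 * T * cos (T * T * (1 + x * x) + phi)) 0 1); [exact D|].
assert (S := fresnel_scale 1 T (T * T + phi)); rewrite Rmult_1_r in S; rewrite <- S.
rewrite <- Rmult_assoc.
rewrite <- (RInt_scal_R (fun x => cos (T * x * (T * x) + (T * T + phi))))
  by (apply ex_RInt_everywhere; intros; cont_derive).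
apply RInt_ext_R; intros x _.
f_equal; f_equal; ring.
Qed.

Lemma RInt_inv_one_plus_sq : RInt (fun x => / (1 + x * x)) 0 1 = PI / 4.
Proof.
apply (is_RInt_unique (V := R_CompleteNormedModule)).
replace (PI / 4) with (minus (atan 1) (atan 0))
 by (rewrite atan_1, atan_0; unfold minus, plus, opp; simpl; ring).
apply (is_RInt_derive (V := R_CompleteNormedModule)).
- intros x _; apply is_derive_atan.
- intros x _; assert (h := one_plus_sq x); cont_derive.
Qed.

(** [I^2] and its antiderivative above differ by a constant, which the value
    [atan 1 = PI / 4] at [T = 0] identifies. *)
Lemma fresnel_square T phi : 0 < T ->
  (FresnelC T ^ 2 - FresnelS T ^ 2) * cos phi - 2 * FresnelC T * FresnelS T * sin phi
  = FresnelG phi T - PI / 4 * sin phi.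
Proof.
intros HT.
set (h := fun T => (FresnelC T ^ 2 - FresnelS T ^ 2) * cos phi
  - 2 * FresnelC T * FresnelS T * sin phi - FresnelG phi T).
assert (E : h 0 = h T).
{ apply (eq_is_derive h 0 T); [|exact HT]; intros t _.
  assert (Dc := FresnelC_derive t); assert (Ds := FresnelS_derive t);
  assert (Dg := FresnelG_derive phi t).
  assert (Uc := is_derive_unique _ _ _ Dc); assert (Us := is_derive_unique _ _ _ Ds);
  assert (Ug := is_derive_unique _ _ _ Dg).
  assert (Ec : ex_derive FresnelC t) by exact (ex_intro _ _ Dc).
  assert (Es : ex_derive FresnelS t) by exact (ex_intro _ _ Ds).
  assert (Eg : ex_derive (FresnelG phi) t) by exact (ex_intro _ _ Dg).
  unfold h; auto_derive; [repeat split; trivial|].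
  change (Derive (fun x => FresnelC x) t) with (Derive FresnelC t);
  change (Derive (fun x => FresnelS x) t) with (Derive FresnelS t);
  change (Derive (fun x => FresnelG phi x) t) with (Derive (FresnelG phi) t).
  rewrite Uc, Us, Ug, cos_plus, sin_plus; unfold zero; simpl; ring. }
assert (C0 : FresnelC 0 = 0) by apply (RInt_point (V := R_CompleteNormedModule)).
assert (S0 : FresnelS 0 = 0) by apply (RInt_point (V := R_CompleteNormedModule)).
assert (G0 : FresnelG phi 0 = PI / 4 * sin phi).
{ unfold FresnelG; rewrite <- RInt_inv_one_plus_sq, (Rmult_comm (RInt _ _ _)).
  rewrite <- (RInt_scal_R (fun x => / (1 + x * x)))
    by (apply ex_RInt_everywhere; intros; assert (q := one_plus_sq x); cont_derive).
  apply RInt_ext_R; intros.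
  now replace (0 * 0 * (1 + x * x) + phi) with phi by ring. }
unfold h in E; rewrite C0, S0, G0 in E; lra.
Qed.

(** Since [1 / (1 + x^2) = 1 - x^2 / (1 + x^2)] and the second term is divisible by the
    derivative of [x^2], the integral is [1 / T] times a bounded Fresnel integral, up to
    [O (1 / T^2)]. *)
Lemma FresnelG_vanishes phi : exists M, forall T, 1 <= T -> Rabs (FresnelG phi T) <= M / T.
Proof.
(* 1 / (1 + x^2) = 1 + w(x) * 2 x *)
set (w := fun x => - (x / (2 * (1 + x * x)))).
destruct (oscillatory_bound 0 1 w (fun x => - ((1 - x * x) / (2 * (1 + x * x) ^ 2))) (fun x => x * x) (fun x => 2 * x))
  as [M1 [HM1 H1]].
- lra.
- intros x _; assert (h := one_plus_sq x); split.
  + unfold w; auto_derive; [lra|field; exact h].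
  + cont_derive; simpl; nra.
- intros x _; split; [auto_derive; [trivial|ring]|cont_derive].
- destruct fresnel_converges as [c [d Hcd]].
  exists (M1 + (Rabs c + 1 + Rabs d + 1)); intros T HT.
  set (psi := T * T + phi - PI / 2).
  assert (E : FresnelG phi T = 1 * RInt (fun x => cos ((T * x) * (T * x) + psi)) 0 1
    + 1 * RInt (fun x => w x * (2 * x) * cos (T * T * (x * x) + psi)) 0 1).
  { rewrite <- RInt_lin2.
    - apply RInt_ext_R; intros x _; assert (h := one_plus_sq x); unfold w.
      replace (T * T * (x * x) + psi) with (T * x * (T * x) + psi) by ring.
      replace (sin (T * T * (1 + x * x) + phi)) with (cos (T * x * (T * x) + psi)).
      + field; exact h.
      + unfold psi; rewrite <- cos_shift, <- cos_neg; f_equal; ring.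
    - apply ex_RInt_everywhere; intros; cont_derive.
    - apply ex_RInt_everywhere; intros; assert (h := one_plus_sq x); unfold w; cont_derive. }
  rewrite E, !Rmult_1_l; clear E.
  assert (TT : T * T >= T) by nra.
  assert (B1 := H1 (T * T) psi ltac:(nra)).
  assert (B2 : M1 / (T * T) <= M1 / T).
  { apply Rmult_le_compat_l; [exact HM1|]; apply Rinv_le_contravar; nra. }
  assert (B3 : Rabs (RInt (fun x => cos (T * x * (T * x) + psi)) 0 1)
     <= (Rabs c + 1 + Rabs d + 1) / T).
  { assert (S := fresnel_scale 1 T psi); rewrite Rmult_1_r in S.
    apply (Rmult_le_reg_l T); [lra|].
    replace (T * ((Rabs c + 1 + Rabs d + 1) / T)) with (Rabs c + 1 + Rabs d + 1) by (field; lra).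
    rewrite <- (Rabs_pos_eq T) at 1 by lra; rewrite <- Rabs_mult, S.
    eapply Rle_trans; [apply Rabs_triang|]; rewrite Rabs_Ropp, !Rabs_mult.
    assert (I : 1 / T <= 1) by (apply (Rmult_le_reg_r T); [lra|]; field_simplify; lra).
    destruct (Hcd T ltac:(lra)) as [Hc' Hd'].
    assert (Rabs (FresnelC T) <= Rabs c + 1).
    { replace (FresnelC T) with (c + (FresnelC T - c)) by ring.
      eapply Rle_trans; [apply Rabs_triang|]; lra. }
    assert (Rabs (FresnelS T) <= Rabs d + 1).
    { replace (FresnelS T) with (d + (FresnelS T - d)) by ring.
      eapply Rle_trans; [apply Rabs_triang|]; lra. }
    generalize (Rabs_cos_le psi) (Rabs_sin_le psi) (Rabs_pos (cos psi)) (Rabs_pos (sin psi))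
      (Rabs_pos (FresnelC T)) (Rabs_pos (FresnelS T)); nra. }
  eapply Rle_trans; [apply Rabs_triang|].
  replace ((M1 + (Rabs c + 1 + Rabs d + 1)) / T) with ((Rabs c + 1 + Rabs d + 1) / T + M1 / T)
    by (field; lra).
  apply Rplus_le_compat; [exact B3|]; eapply Rle_trans; [exact B1|exact B2].
Qed.

(** [|int_0^oo exp (i v^2) dv|^2 = PI / 4]: only the modulus matters for probabilities.
    By [fresnel_square] at [phi = 0] and [phi = - PI / 2], the real part of [I^2] tends to
    [0] and its imaginary part to [PI / 4]. *)
Lemma fresnel_limit : exists c d, c ^ 2 + d ^ 2 = PI / 4 /\
  forall T, 0 < T -> Rabs (FresnelC T - c) <= 1 / T /\ Rabs (FresnelS T - d) <= 1 / T.
Proof.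
destruct fresnel_converges as [c [d Hcd]]; exists c, d; split; [|exact Hcd].
destruct (FresnelG_vanishes 0) as [M1 H1]; destruct (FresnelG_vanishes (- (PI / 2))) as [M2 H2].
assert (Inv : is_lim_seq (fun n => / INR (S n)) 0).
{ apply (is_lim_seq_incr_1 (fun n => / INR n)).
  apply (is_lim_seq_inv INR p_infty); [apply is_lim_seq_INR|easy]. }
assert (Z : forall f l k, (forall n, Rabs (f (INR (S n)) - l) <= k / INR (S n)) ->
   is_lim_seq (fun n => f (INR (S n))) l).
{ intros f l k H.
  assert (Q : is_lim_seq (fun n => k * / INR (S n)) 0).
  { replace (Finite 0) with (Rbar_mult k 0) by (simpl; f_equal; ring).
    apply is_lim_seq_scal_l, Inv. }
  apply (is_lim_seq_le_le (fun n => l - k * / INR (S n)) _ (fun n => l + k * / INR (S n))).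
  - intros n; specialize (H n); apply Rabs_le_between in H; unfold Rdiv in H; lra.
  - replace (Finite l) with (Finite (l - 0)) by (f_equal; ring).
    apply is_lim_seq_minus'; [apply is_lim_seq_const|exact Q].
  - replace (Finite l) with (Finite (l + 0)) by (f_equal; ring).
    apply is_lim_seq_plus'; [apply is_lim_seq_const|exact Q]. }
assert (P1 : forall n, 1 <= INR (S n)).
{ intros n; rewrite S_INR; generalize (pos_INR n); lra. }
assert (Lc : is_lim_seq (fun n => FresnelC (INR (S n))) c)
  by (apply (Z _ _ 1); intros n; exact (proj1 (Hcd _ (Rlt_le_trans _ _ _ Rlt_0_1 (P1 n))))).
assert (Ls : is_lim_seq (fun n => FresnelS (INR (S n))) d)
  by (apply (Z _ _ 1); intros n; exact (proj2 (Hcd _ (Rlt_le_trans _ _ _ Rlt_0_1 (P1 n))))).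
assert (L1 : is_lim_seq (fun n => FresnelG 0 (INR (S n))) 0)
  by (apply (Z _ _ M1); intros n; rewrite Rminus_0_r; apply H1, P1).
assert (L2 : is_lim_seq (fun n => FresnelG (- (PI / 2)) (INR (S n))) 0)
  by (apply (Z _ _ M2); intros n; rewrite Rminus_0_r; apply H2, P1).
assert (E1 : c * c - d * d = 0).
{ assert (A := is_lim_seq_minus' _ _ _ _ (is_lim_seq_mult' _ _ _ _ Lc Lc) (is_lim_seq_mult' _ _ _ _ Ls Ls)).
  apply (is_lim_seq_ext _ (fun n => FresnelG 0 (INR (S n)))) in A.
  - apply is_lim_seq_unique in A; apply is_lim_seq_unique in L1.
    rewrite A in L1; now injection L1.
  - intros n; assert (Q := fresnel_square (INR (S n)) 0 ltac:(generalize (P1 n); lra)).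
    rewrite cos_0, sin_0 in Q; lra. }
assert (E2 : 2 * (c * d) = PI / 4).
{ assert (A := is_lim_seq_mult' _ _ _ _ Lc Ls).
  assert (B := is_lim_seq_plus' _ _ _ _ L2 (is_lim_seq_const (PI / 4))).
  apply (is_lim_seq_ext _ (fun n => 2 * (FresnelC (INR (S n)) * FresnelS (INR (S n))))) in B.
  - apply (is_lim_seq_scal_l _ 2) in A; apply is_lim_seq_unique in A; apply is_lim_seq_unique in B.
    rewrite A in B; injection B; lra.
  - intros n; assert (Q := fresnel_square (INR (S n)) (- (PI / 2)) ltac:(generalize (P1 n); lra)).
    rewrite cos_neg, sin_neg, cos_PI2, sin_PI2 in Q; lra. }
assert (PP := PI_RGT_0).
(* |I|^4 = (Re I^2)^2 + (Im I^2)^2 *)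
assert (E3 : (c ^ 2 + d ^ 2) ^ 2 = (PI / 4) ^ 2).
{ replace ((c ^ 2 + d ^ 2) ^ 2) with ((c * c - d * d) ^ 2 + (2 * (c * d)) ^ 2) by ring.
  rewrite E1, E2; ring. }
assert (0 <= c ^ 2 + d ^ 2) by nra.
nra.
Qed.

Lemma polar_coordinate (x y : R) : x ^ 2 + y ^ 2 = 1 -> exists g, x = cos g /\ y = sin g.
Proof.
intros H.
assert (B : -1 <= x <= 1) by nra.
assert (Q : sqrt (1 - x²) = Rabs y).
{ replace (1 - x²) with (y²) by (unfold Rsqr; lra); apply sqrt_Rsqr_abs. }
destruct (Rle_dec 0 y).
- exists (acos x); rewrite cos_acos, sin_acos, Q, Rabs_pos_eq by lra; auto.
- exists (- acos x); rewrite cos_neg, sin_neg, cos_acos, sin_acos, Q, Rabs_left by lra.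
  split; ring.
Qed.

(** Two Fresnel integrals whose ends move off to infinity like [sqrt s]; [gam] is
    the argument of the full Fresnel integral. *)
Lemma fresnel_two_sided : exists gam, forall a b, 0 < a -> 0 < b ->
  exists M, 0 <= M /\ forall s phi, 0 < s ->
  Rabs (RInt (fun v => cos (s * (v * v) + phi)) (- a) b - sqrt (PI / s) * cos (phi + gam)) <= M / s.
Proof.
assert (PP := PI_RGT_0).
destruct fresnel_limit as [c [d [Hcd Hl]]].
assert (Spi := sqrt_lt_R0 PI PP); assert (Qpi := sqrt_sqrt PI ltac:(lra)).
destruct (polar_coordinate (2 * c / sqrt PI) (2 * d / sqrt PI)) as [gam [Gc Gd]].
{ replace ((2 * c / sqrt PI) ^ 2 + (2 * d / sqrt PI) ^ 2)
   with (4 * (c ^ 2 + d ^ 2) / (sqrt PI * sqrt PI)) by (field; lra).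
  rewrite Qpi, Hcd; field; lra. }
exists gam; intros a b Ha Hb; exists (2 / a + 2 / b); split.
{ assert (0 < 2 / a) by (apply Rdiv_lt_0_compat; lra).
  assert (0 < 2 / b) by (apply Rdiv_lt_0_compat; lra); lra. }
intros s phi Hs.
assert (Ss := sqrt_lt_R0 s Hs); assert (Qs := sqrt_sqrt s ltac:(lra)).
set (u := sqrt s) in *.
assert (Cc : forall x, continuous (fun v => cos (s * (v * v) + phi)) x) by (intros; cont_derive).
rewrite <- (RInt_Chasles_minus _ 0) by exact Cc.
assert (Sc : forall T, u * RInt (fun v => cos (s * (v * v) + phi)) 0 T
   = FresnelC (u * T) * cos phi - FresnelS (u * T) * sin phi).
{ intros T; rewrite <- fresnel_scale; f_equal; apply RInt_ext_R; intros; f_equal; rewrite <- Qs; ring. }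
assert (Odd : forall f T, (forall v, f (- v) = f v) -> (forall v, continuous f v) ->
    RInt f 0 (- T) = - RInt f 0 T).
{ intros f T Hf Cf.
  assert (H := RInt_comp_lin (V := R_CompleteNormedModule) f (-1) 0 0 T).
  replace (-1 * 0 + 0) with 0 in H by ring; replace (-1 * T + 0) with (- T) in H by ring.
  rewrite <- H by now apply ex_RInt_everywhere.
  transitivity (RInt (fun v => (-1) * f v) 0 T).
  - apply RInt_ext_R; intros x _; change (-1 * f (-1 * x + 0) = -1 * f x).
    replace (-1 * x + 0) with (- x) by ring; now rewrite Hf.
  - rewrite RInt_scal_R by (now apply ex_RInt_everywhere); toR; ring. }
assert (Oc : FresnelC (u * - a) = - FresnelC (u * a)).
{ unfold FresnelC; replace (u * - a) with (- (u * a)) by ring; apply Odd.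
  - intros; f_equal; ring.
  - intros; cont_derive. }
assert (Os : FresnelS (u * - a) = - FresnelS (u * a)).
{ unfold FresnelS; replace (u * - a) with (- (u * a)) by ring; apply Odd.
  - intros; f_equal; ring.
  - intros; cont_derive. }
assert (S1 := Sc b); assert (S2 := Sc (- a)); rewrite Oc, Os in S2.
assert (Hua : 0 < u * a) by (apply Rmult_lt_0_compat; lra).
assert (Hub : 0 < u * b) by (apply Rmult_lt_0_compat; lra).
destruct (Hl _ Hua) as [A1 A2]; destruct (Hl _ Hub) as [B1 B2].
set (I1 := RInt _ 0 b : R) in *; set (I2 := RInt _ 0 (- a) : R) in *.
assert (Main : u * (sqrt (PI / s) * cos (phi + gam)) = 2 * c * cos phi - 2 * d * sin phi).
{ rewrite sqrt_div_alt by exact Hs; fold u; rewrite cos_plus, <- Gc, <- Gd; field; split; lra. }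
apply (Rmult_le_reg_l (u * u)); [nra|].
rewrite <- (Rabs_pos_eq (u * u)) at 1 by nra.
rewrite <- Rabs_mult.
replace (u * u * ((2 / a + 2 / b) / s)) with (2 / a + 2 / b) by (rewrite Qs; field; lra).
replace (u * u * (I1 - I2 - sqrt (PI / s) * cos (phi + gam))) with
 (u * ((FresnelC (u * b) - c) * cos phi + (FresnelC (u * a) - c) * cos phi
   - (FresnelS (u * b) - d) * sin phi - (FresnelS (u * a) - d) * sin phi))
 by (transitivity (u * (u * I1 - u * I2 - u * (sqrt (PI / s) * cos (phi + gam)))); [rewrite S1, S2, Main|]; ring).
rewrite Rabs_mult, (Rabs_pos_eq u) by lra.
assert (Cp := Rabs_cos_le phi); assert (Sp := Rabs_sin_le phi).
assert (Bd : forall x y k, Rabs y <= 1 -> Rabs x <= k -> Rabs (x * y) <= k).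
{ intros x y k H1 H2; rewrite Rabs_mult; generalize (Rabs_pos x) (Rabs_pos y); nra. }
assert (K1 := Bd _ _ _ Cp A1); assert (K2 := Bd _ _ _ Cp B1);
assert (K3 := Bd _ _ _ Sp A2); assert (K4 := Bd _ _ _ Sp B2).
apply Rle_trans with (u * (2 * (1 / (u * a)) + 2 * (1 / (u * b)))).
- apply Rmult_le_compat_l; [lra|].
  unfold Rminus at 1 2; eapply Rle_trans; [apply Rabs_triang|]; rewrite Rabs_Ropp.
  eapply Rle_trans; [apply Rplus_le_compat_r, Rabs_triang|]; rewrite Rabs_Ropp.
  eapply Rle_trans; [apply Rplus_le_compat_r, Rplus_le_compat_r, Rabs_triang|]; lra.
- right; field; lra.
Qed.

(** * A nondegenerate critical point *)

(** A smooth function together with all its derivatives. *)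
Definition derivative_tower (D : nat -> R -> R) : Prop :=
  forall n x, is_derive (D n) x (D (S n) x).

Lemma tower_cont D n x : derivative_tower D -> continuous (D n) x.
Proof. intros H; eapply is_derive_continuous, H. Qed.

Lemma tower_C1 D n a b : derivative_tower D -> C1_on a b (D n) (D (S n)).
Proof. intros H x _; split; [apply H|now apply tower_cont]. Qed.

(** Hadamard's lemma, with [G (x) = int_0^1 D' (c + tau (x - c)) dtau]: dividing out a
    zero preserves smoothness, so quotients by [x - c] need no separate treatment at [c]. *)
Lemma hadamard D c : derivative_tower D ->
  exists G, derivative_tower G /\ forall x, D O x = D O c + (x - c) * G O x.
Proof.
intros HD.
exists (fun n x => RInt (fun tau => tau ^ n * D (S n) (c + tau * (x - c))) 0 1); split.
- intros n x.
  apply (is_derive_RInt_param_global (fun u tau => tau ^ n * D (S n) (c + tau * (u - c)))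
    (fun u tau => tau ^ S n * D (S (S n)) (c + tau * (u - c))) 0 1 x).
  + intros u v.
    replace (v ^ S n * D (S (S n)) (c + v * (u - c)))
      with (v ^ n * (v * D (S (S n)) (c + v * (u - c)))) by (simpl; ring).
    apply is_derive_scal.
    apply (is_derive_comp (V := R_NormedModule) (D (S n)) (fun u => c + v * (u - c))); [apply HD|].
    auto_derive; [trivial|ring].
  + intros u v; apply (continuity_2d_pt_mult (fun _ tau => tau ^ S n)).
    * apply (continuity_1d_2d_pt_comp (fun y => y ^ S n) (fun _ v => v)).
      -- apply continuity_pt_of_continuous; cont_derive.
      -- cont2d.
    * apply (continuity_1d_2d_pt_comp (D (S (S n))) (fun u v => c + v * (u - c))).
      -- now apply continuity_pt_of_continuous, tower_cont.
      -- unfold Rminus; cont2d.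
  + intros u v; apply (continuous_mult (fun v => v ^ n) (fun v => D (S n) (c + v * (u - c)))).
    * cont_derive.
    * apply continuous_comp; [cont_derive|now apply tower_cont].
- intros x; rewrite <- RInt_scal_R.
  + assert (I : is_RInt (fun tau => (x - c) * D 1%nat (c + tau * (x - c))) 0 1
       (minus (D O (c + 1 * (x - c))) (D O (c + 0 * (x - c))))).
    { apply (is_RInt_derive (V := R_CompleteNormedModule) (fun tau => D O (c + tau * (x - c)))).
      - intros tau _; apply (is_derive_comp (V := R_NormedModule) (D O) (fun tau => c + tau * (x - c))); [apply HD|].
        auto_derive; [trivial|ring].
      - intros tau _; apply (continuous_scal_r (x - c) (fun tau => D 1%nat (c + tau * (x - c)))).
        apply continuous_comp; [cont_derive|now apply tower_cont]. }
    apply (is_RInt_unique (V := R_CompleteNormedModule)) in I.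
    rewrite (RInt_ext_R _ (fun tau => (x - c) * D 1%nat (c + tau * (x - c)))) by (intros; simpl; ring).
    rewrite I; unfold minus, plus, opp; simpl.
    replace (c + 1 * (x - c)) with x by ring; replace (c + 0 * (x - c)) with c by ring; ring.
  + apply ex_RInt_everywhere; intros v.
    apply (continuous_mult (fun v => v ^ 0) (fun v => D 1%nat (c + v * (x - c)))).
    * cont_derive.
    * apply continuous_comp; [cont_derive|now apply tower_cont].
Qed.

Lemma positive_of_no_zero (f : R -> R) a b c :
  (forall x, continuous f x) -> a <= c <= b -> 0 < f c ->
  (forall x, a <= x <= b -> f x <> 0) -> forall x, a <= x <= b -> 0 < f x.
Proof.
intros Cf Hc Fc H0 x Hx; destruct (Rlt_or_le 0 (f x)) as [|Hn]; [assumption|].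
destruct (IVT_gen f c x 0) as [z [Hz1 Hz2]].
- intros y; apply continuity_pt_of_continuous, Cf.
- rewrite Rmin_right, Rmax_left by lra; lra.
- exfalso; apply (H0 z); [|exact Hz2].
  destruct (Rle_dec c x).
  + rewrite Rmin_left, Rmax_right in Hz1 by lra; lra.
  + rewrite Rmin_right, Rmax_left in Hz1 by lra; lra.
Qed.

(** Morse lemma without inverse functions.  With [u^2 = P - P(c)] one would like to
    substitute [v = u(x)], but the amplitude [1] is not a constant multiple of [u'].  The
    two differ by [w P'] with a regular factor [w], and such a term only contributes
    [O (1 / s)] by [oscillatory_bound]. *)
Lemma critical_normal_form D a b c :
  derivative_tower D -> a < c < b -> D 1%nat c = 0 -> 0 < D 2%nat c ->
  (forall x, a <= x <= b -> D 1%nat x = 0 -> x = c) ->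
  exists u u' w w', C1_on a b u u' /\ C1_on a b w w' /\ u a < 0 < u b /\
    (forall x, a <= x <= b -> D O x = D O c + u x * u x) /\
    (forall x, a <= x <= b -> 1 = sqrt (2 / D 2%nat c) * u' x + w x * D 1%nat x).
Proof.
intros HD Hc H1 H2 Huniq.
destruct (hadamard D c HD) as [q [Tq Eq]].
destruct (hadamard q c Tq) as [r [Tr Er]].
destruct (hadamard r c Tr) as [k [Tk Ek]].
assert (D1 : forall x, D 1%nat x = q O x + (x - c) * q 1%nat x).
{ intros x; assert (Q : is_derive (fun x => D O c + (x - c) * q O x) x (q O x + (x - c) * q 1%nat x)).
  { assert (U := is_derive_unique _ _ _ (Tq O x)).
    auto_derive; [now exists (q 1%nat x)|].
    change (Derive (fun x => q O x) x) with (Derive (q O) x); rewrite U; ring. }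
  apply is_derive_unique in Q; rewrite <- Q, <- (is_derive_unique _ _ _ (HD O x)).
  now apply Derive_ext. }
assert (Q0 : q O c = 0) by (rewrite D1 in H1; lra).
assert (Er' : forall x, q O x = (x - c) * r O x) by (intros x; rewrite (Er x), Q0; ring).
assert (q1 : forall x, q 1%nat x = r O x + (x - c) * r 1%nat x).
{ intros x; assert (Q : is_derive (fun x => (x - c) * r O x) x (r O x + (x - c) * r 1%nat x)).
  { assert (U := is_derive_unique _ _ _ (Tr O x)).
    auto_derive; [now exists (r 1%nat x)|].
    change (Derive (fun x => r O x) x) with (Derive (r O) x); rewrite U; ring. }
  apply is_derive_unique in Q; rewrite <- Q, <- (is_derive_unique _ _ _ (Tq O x)).
  now apply Derive_ext. }
(* m = P' / (x - c) *)
set (m := fun x => 2 * r O x + (x - c) * r 1%nat x).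
set (m' := fun x => 3 * r 1%nat x + (x - c) * r 2%nat x).
assert (Dm : forall x, D 1%nat x = (x - c) * m x) by (intros x; rewrite D1, Er', q1; unfold m; ring).
assert (C1r : C1_on a b (r O) (r 1%nat)) by now apply tower_C1.
assert (C1x : C1_on a b (fun x => x - c) (fun _ => 1)).
{ intros x _; split; [auto_derive; [trivial|ring]|apply continuous_const]. }
assert (Ms : forall x, is_derive m x (m' x)).
{ intros x; assert (U0 := is_derive_unique _ _ _ (Tr O x)); assert (U1 := is_derive_unique _ _ _ (Tr 1%nat x)).
  unfold m; auto_derive; [split; [now exists (r 1%nat x)|split; [now exists (r 2%nat x)|trivial]]|].
  change (Derive (fun x => r O x) x) with (Derive (r O) x);
  change (Derive (fun x => r 1%nat x) x) with (Derive (r 1%nat) x).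
  rewrite U0, U1; unfold m'; ring. }
assert (C1m : C1_on a b m m').
{ intros x _; split; [apply Ms|].
  apply (continuous_plus (fun x => 3 * r 1%nat x) (fun x => (x - c) * r 2%nat x)).
  - apply (continuous_scal_r 3 (r 1%nat)); now apply tower_cont.
  - apply (continuous_mult (fun x => x - c) (r 2%nat)); [cont_derive|now apply tower_cont]. }
assert (A : D 2%nat c = 2 * r O c).
{ assert (Q : is_derive (fun x => (x - c) * m x) c (m c)).
  { assert (U := is_derive_unique _ _ _ (Ms c)).
    auto_derive; [now exists (m' c)|].
    change (Derive (fun x => m x) c) with (Derive m c); rewrite U; ring. }
  apply is_derive_unique in Q; rewrite <- (is_derive_unique _ _ _ (HD 1%nat c)).
  etransitivity; [apply Derive_ext, Dm|]; etransitivity; [exact Q|]; unfold m; ring. }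
assert (Rc : 0 < r O c) by lra.
assert (mpos : forall x, a <= x <= b -> 0 < m x).
{ apply (positive_of_no_zero m a b c).
  - intros x; eapply is_derive_continuous, Ms.
  - lra.
  - unfold m; lra.
  - intros x Hx M0; assert (x = c) as -> by (apply Huniq; [exact Hx|rewrite Dm, M0; ring]).
    unfold m in M0; lra. }
assert (DE : forall x, D O x = D O c + (x - c) * (x - c) * r O x).
{ intros x; rewrite (Eq x), Er'; ring. }
assert (rpos : forall x, a <= x <= b -> 0 < r O x).
{ apply (positive_of_no_zero (r O) a b c).
  - intros x; now apply tower_cont.
  - lra.
  - exact Rc.
  - intros x Hx R0.
    assert (xc : x <> c) by (intros ->; lra).
    assert (E0 : D O x = D O c) by (rewrite (DE x), R0; ring).
    assert (MV : forall y z, y < z -> D O y = D O z -> exists t, D 1%nat t = 0 /\ y < t < z).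
    { intros y z Hyz E; destruct (MVT_cor2 (D O) (D 1%nat) y z Hyz) as [t [Ht1 Ht2]].
      - intros; apply is_derive_Reals, HD.
      - exists t; split; [|exact Ht2].
        rewrite E in Ht1; apply Rmult_eq_reg_r with (z - y); lra. }
    destruct (Rdichotomy _ _ xc) as [Hlt|Hgt].
    + destruct (MV x c Hlt E0) as [t [T1 T2]]; assert (t = c) by (apply Huniq; [lra|exact T1]); lra.
    + destruct (MV c x Hgt (eq_sym E0)) as [t [T1 T2]]; assert (t = c) by (apply Huniq; [lra|exact T1]); lra. }
set (B := r O c) in *.
(* With g = sqrt (B r) the required identity reads 1 = m / (2 g) + w (x - c) m.
   Hence w = (2 g - m) / ((x - c) 2 g m); multiplying through by 2 g + m turns
   the numerator into 4 B r - m^2 = (x - c) n, and the singularity cancels. *)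
assert (C1g : C1_on a b (fun x => sqrt (B * r O x)) (fun x => B * r 1%nat x * / (2 * sqrt (B * r O x)))).
{ apply (C1_on_sqrt a b (fun x => B * r O x) (fun x => B * r 1%nat x)).
  - intros x Hx; apply Rmult_lt_0_compat; [exact Rc|now apply rpos].
  - now apply C1_on_scal. }
set (g := fun x => sqrt (B * r O x)) in *.
assert (gpos : forall x, a <= x <= b -> 0 < g x).
{ intros x Hx; apply sqrt_lt_R0, Rmult_lt_0_compat; [exact Rc|now apply rpos]. }
assert (gsq : forall x, a <= x <= b -> g x * g x = B * r O x).
{ intros x Hx; apply sqrt_sqrt; left; apply Rmult_lt_0_compat; [exact Rc|now apply rpos]. }
set (n := fun x => - (4 * (r O x * k O x)) + (- (4 * (r O x * r 1%nat x)) + - ((x - c) * (r 1%nat x * r 1%nat x)))).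
set (d := fun x => m x * (2 * g x * (2 * g x + m x))).
assert (C1n : exists n', C1_on a b n n').
{ assert (C1k := tower_C1 k 0 a b Tk); assert (C1r' := tower_C1 r 1 a b Tr).
  assert (Op : forall f f', C1_on a b f f' -> C1_on a b (fun x => - f x) (fun x => - f' x)).
  { intros f f' H x Hx; destruct (H x Hx) as [h1 h2]; split.
    - exact (is_derive_opp f x _ h1).
    - exact (continuous_opp f' x h2). }
  eexists; unfold n; apply C1_on_plus; [|apply C1_on_plus]; apply Op.
  - apply C1_on_scal, C1_on_mult; eassumption.
  - apply C1_on_scal, C1_on_mult; eassumption.
  - apply C1_on_mult; [eassumption|apply C1_on_mult; eassumption]. }
destruct C1n as [n' C1n].
assert (dpos : forall x, a <= x <= b -> d x <> 0).
{ intros x Hx; assert (h1 := mpos x Hx); assert (h2 := gpos x Hx); unfold d.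
  apply Rgt_not_eq, Rmult_lt_0_compat; [lra|]; apply Rmult_lt_0_compat; lra. }
assert (C1d : exists d', C1_on a b d d').
{ eexists; unfold d; apply C1_on_mult; [eassumption|]; apply C1_on_mult.
  - apply C1_on_scal; eassumption.
  - apply C1_on_plus; [apply C1_on_scal; eassumption|eassumption]. }
destruct C1d as [d' C1d].
destruct (C1_on_inv a b d d' dpos C1d) as [v' C1v].
exists (fun x => (x - c) * sqrt (r O x)).
exists (fun x => 1 * sqrt (r O x) + (x - c) * (r 1%nat x * / (2 * sqrt (r O x)))).
exists (fun x => n x * / d x).
exists (fun x => n' x * / d x + n x * v' x).
split; [exact (C1_on_mult a b (fun x => x - c) (fun _ => 1) (fun x => sqrt (r O x)) _ C1x
    (C1_on_sqrt a b (r O) (r 1%nat) rpos C1r))|].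
split; [exact (C1_on_mult a b n n' (fun x => / d x) v' C1n C1v)|].
split; [split|split].
- assert (h := sqrt_lt_R0 _ (rpos a ltac:(lra))); nra.
- assert (h := sqrt_lt_R0 _ (rpos b ltac:(lra))); nra.
- intros x Hx; rewrite (DE x) at 1.
  assert (h := sqrt_sqrt _ (Rlt_le _ _ (rpos x Hx))).
  replace ((x - c) * sqrt (r O x) * ((x - c) * sqrt (r O x)))
   with ((x - c) * (x - c) * (sqrt (r O x) * sqrt (r O x))) by ring.
  now rewrite h.
- intros x Hx; rewrite Dm, A.
  assert (rx := rpos x Hx); assert (h := sqrt_lt_R0 _ rx).
  assert (h2 := sqrt_sqrt _ (Rlt_le _ _ rx)).
  assert (hB := sqrt_lt_R0 _ Rc); assert (hB2 := sqrt_sqrt _ (Rlt_le _ _ Rc)).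
  assert (gE : g x = sqrt B * sqrt (r O x)) by (unfold g; apply sqrt_mult; lra).
  replace (2 / (2 * B)) with (/ B) by (field; lra).
  rewrite sqrt_inv.
  assert (mx := mpos x Hx); assert (gx := gpos x Hx); assert (g2 := gsq x Hx).
  assert (E1 : / sqrt B * (1 * sqrt (r O x) + (x - c) * (r 1%nat x * / (2 * sqrt (r O x)))) = m x / (2 * g x)).
  { rewrite gE; unfold m; set (y := sqrt (r O x)) in *; rewrite <- h2; field; split; lra. }
  rewrite E1.
  assert (E2 : (x - c) * n x = 4 * (g x * g x) - m x * m x).
  { assert (e2 : (x - c) * k O x = r O x - B) by (generalize (Ek x); fold B; lra).
    rewrite g2; unfold m, n.
    transitivity (- 4 * r O x * ((x - c) * k O x) - 4 * r O x * ((x - c) * r 1%nat x)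
      - (x - c) * (x - c) * (r 1%nat x * r 1%nat x)); [ring|rewrite e2; ring]. }
  transitivity (m x / (2 * g x) + ((x - c) * n x) * m x / d x); [|unfold Rdiv; ring].
  rewrite E2; unfold d; field; repeat split; lra.
Qed.

(** After [critical_normal_form] the leading part is a two-sided Fresnel integral by
    the substitution [v = u(x)]. *)
Lemma stationary_phase_minimum : exists gam, forall D a b c,
  derivative_tower D -> a < c < b -> D 1%nat c = 0 -> 0 < D 2%nat c ->
  (forall x, a <= x <= b -> D 1%nat x = 0 -> x = c) ->
  exists M, 0 <= M /\ forall s phi, 0 < s ->
  Rabs (RInt (fun x => cos (s * D O x + phi)) a b
        - sqrt (2 * PI / (D 2%nat c * s)) * cos (s * D O c + phi + gam)) <= M / s.
Proof.
destruct fresnel_two_sided as [gam Hgam]; exists gam.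
intros D a b c HD Hc H1 H2 Huniq.
destruct (critical_normal_form D a b c HD Hc H1 H2 Huniq)
  as [u [u' [w [w' [Cu [Cw [[ua ub] [Eu Ew]]]]]]]].
destruct (Hgam (- u a) (u b)) as [M1 [HM1 B1]]; [lra|lra|].
destruct (oscillatory_bound a b w w' (D O) (D 1%nat)) as [M2 [HM2 B2]]; [lra|exact Cw|now apply tower_C1|].
assert (PP := PI_RGT_0).
set (k := sqrt (2 / D 2%nat c)) in *.
assert (k0 : 0 < k) by (apply sqrt_lt_R0, Rdiv_lt_0_compat; lra).
exists (k * M1 + M2); split; [nra|].
intros s phi Hs.
set (f1 := fun x => u' x * cos (s * (u x * u x) + (s * D O c + phi))).
set (f2 := fun x => w x * D 1%nat x * cos (s * D O x + phi)).
assert (CD : forall n x, continuous (D n) x) by (intros; now apply tower_cont).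
assert (CU : forall x, a <= x <= b -> continuous u x) by (intros; eapply C1_on_cont; eauto).
assert (Ex1 : ex_RInt f1 a b).
{ apply ex_RInt_on; [lra|]; intros x Hx; apply (continuous_mult u'); [now apply Cu|].
  apply continuous_cos_comp, (continuous_affine (fun x => u x * u x)).
  apply (continuous_mult u u); now apply CU. }
assert (Ex2 : ex_RInt f2 a b).
{ apply ex_RInt_on; [lra|]; intros x Hx; apply (continuous_mult (fun x => w x * D 1%nat x)).
  - apply (continuous_mult w (D 1%nat)); [eapply C1_on_cont; eauto|apply CD].
  - apply continuous_cos_comp, continuous_affine, CD. }
assert (E : RInt (fun x => cos (s * D O x + phi)) a b = k * RInt f1 a b + 1 * RInt f2 a b).
{ rewrite <- RInt_lin2 by assumption; apply RInt_ext_R; intros x.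
  rewrite Rmin_left, Rmax_right by lra; intros Hx; unfold f1, f2.
  replace (s * (u x * u x) + (s * D O c + phi)) with (s * D O x + phi) by (rewrite (Eu x) by lra; ring).
  rewrite <- (Rmult_1_l (cos _)) at 1; rewrite (Ew x) at 1 by lra; ring. }
assert (S : RInt f1 a b = RInt (fun v => cos (s * (v * v) + (s * D O c + phi))) (- - u a) (u b)).
{ rewrite Ropp_involutive.
  apply (RInt_comp (V := R_CompleteNormedModule) (fun v => cos (s * (v * v) + (s * D O c + phi))) u u').
  - intros; cont_derive.
  - intros x; rewrite Rmin_left, Rmax_right by lra; apply Cu. }
assert (A1 := B1 s (s * D O c + phi) Hs); rewrite <- S in A1.
assert (A2 := B2 s phi Hs); fold f2 in A2.
assert (Sq : sqrt (2 * PI / (D 2%nat c * s)) = k * sqrt (PI / s)).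
{ unfold k; rewrite <- sqrt_mult_alt by (left; apply Rdiv_lt_0_compat; lra).
  f_equal; field; lra. }
rewrite E, Sq.
replace (k * RInt f1 a b + 1 * RInt f2 a b - k * sqrt (PI / s) * cos (s * D O c + phi + gam))
  with (k * (RInt f1 a b - sqrt (PI / s) * cos (s * D O c + phi + gam)) + RInt f2 a b) by (toR; ring).
eapply Rle_trans; [apply Rabs_triang|]; rewrite Rabs_mult, (Rabs_pos_eq k) by lra.
replace ((k * M1 + M2) / s) with (k * (M1 / s) + M2 / s) by (field; lra).
apply Rplus_le_compat; [apply Rmult_le_compat_l; lra|exact A2].
Qed.

(** A maximum of [P] is a minimum of [- P], and
    [cos (s P + phi) = cos (s (- P) - phi)]. *)
Lemma stationary_phase_point : exists gam, forall D a b c,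
  derivative_tower D -> a < c < b -> D 1%nat c = 0 -> D 2%nat c <> 0 ->
  (forall x, a <= x <= b -> D 1%nat x = 0 -> x = c) ->
  exists M, 0 <= M /\ forall s phi, 0 < s ->
  Rabs (RInt (fun x => cos (s * D O x + phi)) a b
        - sqrt (2 * PI / (Rabs (D 2%nat c) * s)) * cos (s * D O c + phi + sign (D 2%nat c) * gam)) <= M / s.
Proof.
destruct stationary_phase_minimum as [gam H]; exists gam.
intros D a b c HD Hc H1 H2 Huniq.
destruct (Rlt_or_le 0 (D 2%nat c)) as [Hp|Hn].
- destruct (H D a b c HD Hc H1 Hp Huniq) as [M [HM B]]; exists M; split; [exact HM|].
  intros s phi Hs; rewrite sign_eq_1, Rmult_1_l, (Rabs_pos_eq (D 2%nat c)) by lra; now apply B.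
- assert (Hm : 0 < - D 2%nat c) by lra.
  destruct (H (fun n x => - D n x) a b c) as [M [HM B]].
  + intros n x; exact (is_derive_opp (D n) x _ (HD n x)).
  + exact Hc.
  + lra.
  + exact Hm.
  + intros x Hx E; apply Huniq; [exact Hx|lra].
  + exists M; split; [exact HM|]; intros s phi Hs.
    rewrite sign_eq_m1, (Rabs_left (D 2%nat c)) by lra.
    rewrite (RInt_ext_R _ (fun x => cos (s * - D O x + - phi))).
    * replace (cos (s * D O c + phi + -1 * gam)) with (cos (s * - D O c + - phi + gam)).
      -- now apply B.
      -- rewrite <- cos_neg; f_equal; ring.
    * intros x _; rewrite <- cos_neg; f_equal; ring.
Qed.

(** * Stationary phase on an interval *)

Definition lsum (f : R -> R) (l : list R) : R := fold_right (fun c acc => f c + acc) 0 l.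

Lemma lsum_nil f : lsum f nil = 0.
Proof. reflexivity. Qed.

Lemma lsum_cons f c l : lsum f (c :: l) = f c + lsum f l.
Proof. reflexivity. Qed.

Lemma lsum_perm f l l' : Permutation l l' -> lsum f l = lsum f l'.
Proof. unfold lsum; induction 1; simpl; lra. Qed.

Lemma list_max_split (l : list R) : l <> nil ->
  exists c l', Permutation l (c :: l') /\ forall x, In x l' -> x <= c.
Proof.
induction l as [|d l IH]; [easy|intros _].
destruct l as [|e l].
{ exists d, nil; split; [apply Permutation_refl|easy]. }
destruct (IH ltac:(discriminate)) as [c [l' [Hp Hm]]].
destruct (Rle_dec d c).
- exists c, (d :: l'); split.
  + eapply Permutation_trans; [apply perm_skip, Hp|apply perm_swap].
  + intros x [<-|Hx]; [assumption|now apply Hm].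
- exists d, (c :: l'); split; [now apply perm_skip|].
  intros x [<-|Hx]; [lra|]; specialize (Hm x Hx); lra.
Qed.

Definition stationary_term (D : nat -> R -> R) (gam s phi c : R) : R :=
  sqrt (2 * PI / Rabs (D 2%nat c)) * cos (s * D O c + (sign (D 2%nat c) * gam + phi)).

(** Without critical points [1 = (1 / P') P'] is a multiple of [P'] itself. *)
Lemma no_stationary_point D a b : derivative_tower D -> a <= b ->
  (forall x, a <= x <= b -> D 1%nat x <> 0) ->
  exists M, 0 <= M /\ forall s phi, 0 < s ->
  Rabs (RInt (fun x => cos (s * D O x + phi)) a b) <= M / s.
Proof.
intros HD Hab H0.
destruct (C1_on_inv a b (D 1%nat) (D 2%nat) H0 (tower_C1 D 1 a b HD)) as [w' Cw].
destruct (oscillatory_bound a b _ w' (D O) (D 1%nat) Hab Cw (tower_C1 D 0 a b HD)) as [M [HM B]].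
exists M; split; [exact HM|]; intros s phi Hs.
rewrite (RInt_ext_R _ (fun x => / D 1%nat x * D 1%nat x * cos (s * D O x + phi))); [now apply B|].
intros x; rewrite Rmin_left, Rmax_right by lra; intros Hx.
rewrite Rinv_l, Rmult_1_l by (apply H0; lra); reflexivity.
Qed.

(** Induction on the number of critical points: the last one is cut off at the midpoint
    between it and its predecessor. *)
Lemma stationary_phase : exists gam, forall D, derivative_tower D ->
  forall l a b, a < b -> D 1%nat a <> 0 -> D 1%nat b <> 0 -> NoDup l ->
  (forall x, In x l <-> a <= x <= b /\ D 1%nat x = 0) ->
  (forall x, In x l -> D 2%nat x <> 0) ->
  exists M, 0 <= M /\ forall s phi, 0 < s ->
  Rabs (RInt (fun x => cos (s * D O x + phi)) a b
        - lsum (stationary_term D gam s phi) l / sqrt s) <= M / s.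
Proof.
destruct stationary_phase_point as [gam Hgam]; exists gam; intros D HD l.
assert (CD : forall n x, continuous (D n) x) by (intros; now apply tower_cont).
assert (PP := PI_RGT_0).
remember (length l) as n eqn:Hn; revert l Hn; induction n as [|n IH]; intros l Hn a b Hab Ha Hb Hnd Hin H2.
- destruct l as [|c l]; [|discriminate].
  destruct (no_stationary_point D a b HD ltac:(lra)) as [M [HM B]].
  { intros x Hx E; apply (proj2 (Hin x)); tauto. }
  exists M; split; [exact HM|]; intros s phi Hs; simpl; unfold Rdiv at 1.
  rewrite Rmult_0_l, Rminus_0_r; now apply B.
- destruct (list_max_split l) as [c [l' [Hp Hm]]]; [intros ->; discriminate|].
  assert (Hin' : forall x, (x = c \/ In x l') <-> a <= x <= b /\ D 1%nat x = 0).
  { intros x; rewrite <- Hin; split; intros Hx.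
    - apply (Permutation_in _ (Permutation_sym Hp)); destruct Hx as [->|Hx]; [now left|now right].
    - apply (Permutation_in _ Hp) in Hx; destruct Hx as [->|Hx]; [now left|now right]. }
  assert (Hnd' := Permutation_NoDup Hp Hnd); inversion_clear Hnd' as [|? ? Hc Hl'].
  destruct (list_max_split (a :: l')) as [y0 [l'' [Hp' Hm']]]; [discriminate|].
  assert (Y0 : y0 = a \/ In y0 l').
  { assert (In y0 (a :: l')) as [|] by (apply (Permutation_in _ (Permutation_sym Hp')); now left); auto. }
  assert (Ymax : forall x, In x (a :: l') -> x <= y0).
  { intros x Hx; apply (Permutation_in _ Hp') in Hx; destruct Hx as [->|Hx]; [lra|now apply Hm']. }
  destruct (proj1 (Hin' c) (or_introl eq_refl)) as [Hcab Hc1].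
  assert (c <> a) by (intros ->; tauto); assert (c <> b) by (intros ->; tauto).
  assert (Hyc : y0 < c).
  { destruct Y0 as [->|Hy]; [lra|].
    assert (y0 <> c) by (intros ->; tauto); specialize (Hm y0 Hy); lra. }
  assert (Hay : a <= y0) by (apply Ymax; now left).
  (* y0 is the last of a and the critical points before c, so y is not critical. *)
  set (y := (y0 + c) / 2).
  assert (Hy : y0 < y < c) by (unfold y; lra).
  assert (Dy : D 1%nat y <> 0).
  { intros E; destruct (proj2 (Hin' y)) as [Q|Q]; [split; [lra|exact E]|lra|].
    specialize (Ymax y (or_intror Q)); lra. }
  assert (Hdec : forall x, In x l' -> D 2%nat x <> 0).
  { intros x Hx; apply H2, (Permutation_in _ (Permutation_sym Hp)); now right. }
  destruct (IH l') with (a := a) (b := y) as [M1 [HM1 B1]].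
  + apply Permutation_length in Hp; simpl in Hp; lia.
  + lra.
  + exact Ha.
  + exact Dy.
  + exact Hl'.
  + intros x; split; intros Hx.
    * destruct (proj1 (Hin' x) (or_intror Hx)) as [Q1 Q2].
      specialize (Ymax x (or_intror Hx)); split; [lra|exact Q2].
    * destruct Hx as [Q1 Q2]; destruct (proj2 (Hin' x)) as [Q|Q]; [split; [lra|exact Q2]|lra|exact Q].
  + exact Hdec.
  + destruct (Hgam D y b c HD) as [M2 [HM2 B2]].
    * lra.
    * exact Hc1.
    * apply H2, (Permutation_in _ (Permutation_sym Hp)); now left.
    * intros x Hx E; destruct (proj2 (Hin' x)) as [Q|Q]; [split; [lra|exact E]|exact Q|].
      specialize (Ymax x (or_intror Q)); lra.
    * exists (M1 + M2); split; [lra|]; intros s phi Hs.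
      assert (Ss := sqrt_lt_R0 s Hs).
      rewrite (lsum_perm _ _ _ Hp); simpl; fold (lsum (stationary_term D gam s phi) l').
      specialize (B1 s phi Hs); specialize (B2 s phi Hs).
      set (I1 := RInt (fun x => cos (s * D O x + phi)) a y : R) in *.
      set (I2 := RInt (fun x => cos (s * D O x + phi)) y b : R) in *.
      assert (HI : RInt (fun x => cos (s * D O x + phi)) a b = I1 + I2).
      { symmetry; apply (RInt_Chasles (V := R_CompleteNormedModule));
        apply ex_RInt_everywhere; intros x; apply continuous_cos_comp, continuous_affine, CD. }
      assert (HT : sqrt (2 * PI / (Rabs (D 2%nat c) * s))
          * cos (s * D O c + phi + sign (D 2%nat c) * gam) = stationary_term D gam s phi c / sqrt s).
      { unfold stationary_term.
        assert (0 < Rabs (D 2%nat c)) by (apply Rabs_pos_lt, H2, (Permutation_in _ (Permutation_sym Hp)); now left).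
        replace (2 * PI / (Rabs (D 2%nat c) * s)) with (2 * PI / Rabs (D 2%nat c) / s) by (field; lra).
        rewrite sqrt_div_alt by exact Hs.
        replace (s * D O c + phi + sign (D 2%nat c) * gam) with (s * D O c + (sign (D 2%nat c) * gam + phi)) by ring.
        field; lra. }
      rewrite HT in B2; rewrite HI.
      set (T := stationary_term D gam s phi c) in *; set (L := lsum _ l') in *.
      replace (I1 + I2 - (T + L) / sqrt s) with ((I1 - L / sqrt s) + (I2 - T / sqrt s)) by (field; lra).
      eapply Rle_trans; [apply Rabs_triang|].
      replace ((M1 + M2) / s) with (M1 / s + M2 / s) by (field; lra); lra.
Qed.

(** * Averages over a window *)

Lemma lsum_continuous (f : R -> R -> R) l x :
  (forall c, continuous (f c) x) -> continuous (fun s => lsum (fun c => f c s) l) x.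
Proof.
intros H; induction l as [|c l IH]; simpl; [apply continuous_const|].
apply (continuous_plus (f c) (fun s => lsum (fun c => f c s) l)); [apply H|exact IH].
Qed.

Lemma lsum_ext f g l : (forall c, In c l -> f c = g c) -> lsum f l = lsum g l.
Proof.
induction l as [|c l IH]; intros H; [reflexivity|rewrite !lsum_cons].
f_equal; [apply H; now left|apply IH; intros; apply H; now right].
Qed.

Lemma lsum_scal k f l : lsum (fun c => k * f c) l = k * lsum f l.
Proof. induction l as [|c l IH]; rewrite ?lsum_nil, ?lsum_cons; [ring|rewrite IH; ring]. Qed.

Lemma lsum_plus f g l : lsum (fun c => f c + g c) l = lsum f l + lsum g l.
Proof. induction l as [|c l IH]; rewrite ?lsum_nil, ?lsum_cons; [ring|rewrite IH; ring]. Qed.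

Lemma lsum_abs_le f g l : (forall c, Rabs (f c) <= g c) -> Rabs (lsum f l) <= lsum g l.
Proof.
intros H; induction l as [|c l IH]; rewrite ?lsum_nil, ?lsum_cons; [rewrite Rabs_R0; lra|].
eapply Rle_trans; [apply Rabs_triang|]; generalize (H c); lra.
Qed.

(** On the window [1 / s] varies by a fraction [1 / sqrt t], the relative length of the
    window. *)
Lemma window_reciprocal t : 1 <= t ->
  Rabs (RInt (fun s => / s) t (t + sqrt t) - / sqrt t) <= / t.
Proof.
intros Ht.
assert (S0 := sqrt_lt_R0 t ltac:(lra)); assert (S2 := sqrt_sqrt t ltac:(lra)).
set (r := sqrt t) in *.
assert (C : forall x, t <= x <= t + r -> continuous (fun s => / s) x) by (intros; cont_derive; lra).
assert (E1 : ex_RInt (fun s => / s) t (t + r)) by (apply ex_RInt_on; [lra|exact C]).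
assert (E2 : ex_RInt (fun _ : R => / t) t (t + r)) by (apply ex_RInt_const).
assert (I : RInt (fun s => 1 * / s + (-1) * / t) t (t + r) = RInt (fun s => / s) t (t + r) - / r).
{ rewrite (RInt_lin2 (fun s => / s) (fun _ => / t)) by assumption.
  assert (Hr : RInt (fun _ : R => / t) t (t + r) = / r).
  { rewrite (RInt_const (V := R_CompleteNormedModule)).
    change ((t + r - t) * / t = / r); rewrite <- S2; field; lra. }
  rewrite Hr; toR; ring. }
rewrite <- I.
eapply Rle_trans.
- apply abs_RInt_le_const with (M := / t - / (t + r)); [lra| |].
  + apply ex_RInt_on; [lra|]; intros x Hx.
    apply (continuous_plus (fun s => 1 * / s) (fun _ => -1 * / t)); [|apply continuous_const].
    apply (continuous_scal_r 1 (fun s => / s)), C, Hx.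
  + intros x Hx.
    assert (/ x <= / t) by (apply Rinv_le_contravar; lra).
    assert (/ (t + r) <= / x) by (apply Rinv_le_contravar; lra).
    apply Rabs_le; lra.
- replace ((t + r - t) * (/ t - / (t + r))) with (/ (t + r) * ((r * r) / t)) by (field; lra).
  rewrite S2; replace (t / t) with 1 by (field; lra); rewrite Rmult_1_r.
  apply Rinv_le_contravar; lra.
Qed.

Lemma window_oscillatory om g t : om <> 0 -> 1 <= t ->
  Rabs (RInt (fun s => cos (s * om + g) / s) t (t + sqrt t)) <= 2 * Rabs (/ om) / t.
Proof.
intros Ho Ht.
assert (S0 := sqrt_lt_R0 t ltac:(lra)).
rewrite (RInt_ext_R _ (fun s => (/ om) / s * om * cos (s * om + g))).
- apply (oscillatory_reciprocal t (t + sqrt t) (/ om) (fun s => s * om) (fun _ => om)); [lra|].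
  intros x _; split; [auto_derive; [trivial|ring]|apply continuous_const].
- intros x; rewrite Rmin_left, Rmax_right by lra; intros Hx; field; lra.
Qed.

Lemma ex_RInt_window (f : R -> R) t : 1 <= t -> (forall s, continuous f s) ->
  ex_RInt (fun s => f s / s) t (t + sqrt t).
Proof.
intros Ht Cf; assert (S0 := sqrt_lt_R0 t ltac:(lra)).
apply ex_RInt_on; [lra|]; intros x Hx.
apply (continuous_mult f (fun s => / s)); [apply Cf|cont_derive; lra].
Qed.

Lemma window_plus (f g : R -> R) k t : 1 <= t ->
  (forall s, continuous f s) -> (forall s, continuous g s) ->
  RInt (fun s => (f s + k * g s) / s) t (t + sqrt t)
  = RInt (fun s => f s / s) t (t + sqrt t) + k * RInt (fun s => g s / s) t (t + sqrt t).
Proof.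
intros Ht Cf Cg.
rewrite <- (Rmult_1_l (RInt (fun s => f s / s) t (t + sqrt t))).
rewrite <- RInt_lin2 by now apply ex_RInt_window.
apply RInt_ext_R; intros; unfold Rdiv; ring.
Qed.

Lemma continuous_cos_freq om g s : continuous (fun s => cos (s * om + g)) s.
Proof. cont_derive. Qed.

Lemma continuous_sin_freq om g s : continuous (fun s => sin (s * om + g)) s.
Proof. cont_derive. Qed.

Lemma window_oscillatory_sum (k om g : R -> R) l : (forall d, In d l -> om d <> 0) ->
  exists M, 0 <= M /\ forall t, 1 <= t ->
  Rabs (RInt (fun s => lsum (fun d => k d * cos (s * om d + g d)) l / s) t (t + sqrt t)) <= M / t.
Proof.
induction l as [|d l IH]; intros H0.
- exists 0; split; [lra|]; intros t Ht; simpl.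
  rewrite (RInt_ext_R _ (fun _ => 0)) by (intros; unfold Rdiv; ring).
  rewrite (RInt_const (V := R_CompleteNormedModule)); unfold scal; simpl; unfold mult; simpl.
  rewrite Rmult_0_r, Rabs_R0; unfold Rdiv; lra.
- destruct IH as [M [HM B]]; [intros; apply H0; now right|].
  exists (Rabs (k d) * (2 * Rabs (/ om d)) + M); split.
  { generalize (Rabs_pos (k d)) (Rabs_pos (/ om d)); nra. }
  intros t Ht; simpl.
  rewrite (RInt_ext_R _ (fun s => (lsum (fun d => k d * cos (s * om d + g d)) l + k d * cos (s * om d + g d)) / s))
    by (intros; unfold Rdiv; unfold lsum; ring).
  rewrite window_plus; [|exact Ht| |intros; apply continuous_cos_freq].
  + eapply Rle_trans; [apply Rabs_triang|]; rewrite Rabs_mult.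
    specialize (B t Ht); assert (W := window_oscillatory (om d) (g d) t (H0 d (or_introl eq_refl)) Ht).
    apply (Rmult_le_compat_l (Rabs (k d))) in W; [|apply Rabs_pos].
    replace ((Rabs (k d) * (2 * Rabs (/ om d)) + M) / t)
     with (M / t + Rabs (k d) * (2 * Rabs (/ om d) / t)) by (field; lra); lra.
  + intros s; apply (lsum_continuous (fun d s => k d * cos (s * om d + g d))).
    intros e; apply (continuous_scal_r (k e) (fun s => cos (s * om e + g e))), continuous_cos_freq.
Qed.

(** The squared modulus of [sum_c b_c exp (i (s om_c + g_c))]. *)
Definition energy (b om g : R -> R) (l : list R) (s : R) : R :=
  lsum (fun c => b c * cos (s * om c + g c)) l ^ 2
  + lsum (fun c => b c * sin (s * om c + g c)) l ^ 2.

Lemma energy_continuous b om g l s : continuous (energy b om g l) s.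
Proof.
assert (Sq : forall f : R -> R, continuous f s -> continuous (fun s => f s ^ 2) s).
{ intros f Cf; apply (continuous_comp f (fun y => y ^ 2)); [exact Cf|cont_derive]. }
apply (continuous_plus (fun s => _ ^ 2) (fun s => _ ^ 2)); apply Sq.
- apply (lsum_continuous (fun c s => b c * cos (s * om c + g c))).
  intros e; apply (continuous_scal_r (b e) (fun s => cos (s * om e + g e))), continuous_cos_freq.
- apply (lsum_continuous (fun c s => b c * sin (s * om c + g c))).
  intros e; apply (continuous_scal_r (b e) (fun s => sin (s * om e + g e))), continuous_sin_freq.
Qed.

(** Expanding the square separates the diagonal term of [c] from its interference with
    the others, which oscillates with the differences of the frequencies. *)
Lemma energy_cons b om g c l s :
  energy b om g (c :: l) s
  = energy b om g l s + 1 * (b c ^ 2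
    + (2 * b c) * lsum (fun d => b d * cos (s * (om c - om d) + (g c - g d))) l).
Proof.
assert (E : lsum (fun d => b d * cos (s * (om c - om d) + (g c - g d))) l
  = cos (s * om c + g c) * lsum (fun d => b d * cos (s * om d + g d)) l
    + sin (s * om c + g c) * lsum (fun d => b d * sin (s * om d + g d)) l).
{ rewrite <- !lsum_scal, <- lsum_plus; apply lsum_ext; intros d _.
  replace (s * (om c - om d) + (g c - g d)) with ((s * om c + g c) - (s * om d + g d)) by ring.
  rewrite cos_minus; ring. }
rewrite E; unfold energy; rewrite !lsum_cons.
assert (P := sin2_cos2 (s * om c + g c)); unfold Rsqr in P.
set (S := sin _) in *; set (C := cos _) in *.
set (A := lsum _ l); set (B := lsum _ l).
replace (b c ^ 2) with (b c ^ 2 * (S * S + C * C)) by (rewrite P; ring); ring.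
Qed.

(** Interference averages out.  This is where the frequencies have to be distinct: the
    window is long enough for a fixed nonzero frequency to gain a factor [1 / sqrt t]. *)
Lemma window_energy b om g l : NoDup l ->
  (forall c d, In c l -> In d l -> c <> d -> om c <> om d) ->
  exists M, 0 <= M /\ forall t, 1 <= t ->
  Rabs (RInt (fun s => energy b om g l s / s) t (t + sqrt t)
        - lsum (fun c => b c ^ 2) l / sqrt t) <= M / t.
Proof.
induction l as [|c l IH]; intros Hnd Hom.
- exists 0; split; [lra|]; intros t Ht.
  rewrite (RInt_ext_R _ (fun _ => 0)) by (intros; unfold energy; simpl; unfold Rdiv; ring).
  rewrite (RInt_const (V := R_CompleteNormedModule)).
  change (Rabs ((t + sqrt t - t) * 0 - 0 / sqrt t) <= 0 / t); unfold Rdiv.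
  rewrite Rmult_0_r, !Rmult_0_l, Rminus_0_r, Rabs_R0; lra.
- inversion_clear Hnd as [|? ? Hc Hl].
  destruct IH as [M [HM B]]; [exact Hl|intros; apply Hom; auto; now right|].
  destruct (window_oscillatory_sum b (fun d => om c - om d) (fun d => g c - g d) l) as [M' [HM' B']].
  { intros d Hd E; apply (Hom c d); [now left|now right|intros ->; tauto|lra]. }
  exists (M + b c ^ 2 + 2 * Rabs (b c) * M'); split.
  { generalize (Rabs_pos (b c)) (pow2_ge_0 (b c)); nra. }
  intros t Ht.
  set (X := fun s => lsum (fun d => b d * cos (s * (om c - om d) + (g c - g d))) l).
  assert (CX : forall s, continuous X s).
  { intros s; apply (lsum_continuous (fun d s => b d * cos (s * (om c - om d) + (g c - g d)))).
    intros d; apply (continuous_scal_r (b d) (fun s => cos (s * (om c - om d) + (g c - g d)))), continuous_cos_freq. }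
  rewrite (RInt_ext_R _ (fun s => (energy b om g l s + 1 * (b c ^ 2 + (2 * b c) * X s)) / s))
    by (intros; now rewrite energy_cons).
  rewrite (window_plus (energy b om g l) (fun s => b c ^ 2 + (2 * b c) * X s) 1 t Ht).
  2: intros; apply energy_continuous.
  2: { intros s; apply (continuous_plus (fun _ => b c ^ 2) (fun s => (2 * b c) * X s)).
       - apply continuous_const.
       - apply (continuous_scal_r (2 * b c) X), CX. }
  rewrite (window_plus (fun _ => b c ^ 2) X (2 * b c) t Ht); [|intros; apply continuous_const|exact CX].
  rewrite (RInt_ext_R (fun s => b c ^ 2 / s) (fun s => b c ^ 2 * / s)) by reflexivity.
  rewrite RInt_scal_R.
  2: { assert (S0 := sqrt_lt_R0 t ltac:(lra)); apply ex_RInt_on; [lra|]; intros x Hx; cont_derive; lra. }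
  specialize (B t Ht); specialize (B' t Ht); change (Rabs (RInt (fun s => X s / s) t (t + sqrt t)) <= M' / t) in B'; assert (W := window_reciprocal t Ht).
  rewrite lsum_cons.
  set (I1 := RInt (fun s => energy b om g l s / s) t (t + sqrt t) : R) in *.
  set (I2 := RInt (fun s => / s) t (t + sqrt t) : R) in *.
  set (I3 := RInt (fun s => X s / s) t (t + sqrt t) : R) in *.
  set (L := lsum _ l) in *.
  replace (I1 + 1 * (b c ^ 2 * I2 + 2 * b c * I3) - (b c ^ 2 + L) / sqrt t)
    with ((I1 - L / sqrt t) + (b c ^ 2 * (I2 - / sqrt t)) + 2 * b c * I3) by (unfold Rdiv; ring).
  eapply Rle_trans; [apply Rabs_triang|].
  eapply Rle_trans; [apply Rplus_le_compat_r, Rabs_triang|].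
  rewrite !Rabs_mult, (Rabs_pos_eq 2), (Rabs_pos_eq (b c ^ 2)) by (lra || apply pow2_ge_0).
  apply (Rmult_le_compat_l (b c ^ 2)) in W; [|apply pow2_ge_0].
  apply (Rmult_le_compat_l (2 * Rabs (b c))) in B'; [|generalize (Rabs_pos (b c)); lra].
  unfold Rdiv in *; lra.
Qed.

(** Squaring an approximation: an error [1 / s] against a main term [1 / sqrt s] leaves
    an error [1 / s^(3/2)], which is the precision of the final estimate. *)
Lemma square_close (x A s M B : R) : 1 <= s -> 0 <= M -> Rabs A <= B ->
  Rabs (x - A / sqrt s) <= M / s ->
  Rabs (x ^ 2 - A ^ 2 / s) <= (M * M + 2 * M * B) / (s * sqrt s).
Proof.
intros Hs HM HA H.
assert (S0 := sqrt_lt_R0 s ltac:(lra)); assert (S2 := sqrt_sqrt s ltac:(lra)).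
assert (S1 : 1 <= sqrt s) by (rewrite <- sqrt_1; apply sqrt_le_1_alt, Hs).
set (r := sqrt s) in *.
replace (x ^ 2 - A ^ 2 / s) with ((x - A / r) * ((x - A / r) + 2 * A / r)) by (rewrite <- S2; field; lra).
rewrite Rabs_mult.
assert (H' : Rabs (x - A / r + 2 * A / r) <= (M + 2 * B) / r).
{ eapply Rle_trans; [apply Rabs_triang|].
  unfold Rdiv at 2; rewrite !Rabs_mult, Rabs_inv, (Rabs_pos_eq 2), (Rabs_pos_eq r) by lra.
  assert (M / s <= M / r).
  { apply Rmult_le_compat_l; [exact HM|]; apply Rinv_le_contravar; nra. }
  assert (2 * Rabs A * / r <= 2 * B * / r).
  { apply Rmult_le_compat_r; [left; now apply Rinv_0_lt_compat|lra]. }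
  unfold Rdiv in *; lra. }
replace ((M * M + 2 * M * B) / (s * r)) with ((M / s) * ((M + 2 * B) / r)) by (field; split; lra).
apply Rmult_le_compat; auto using Rabs_pos.
Qed.

Lemma Rabs_mult_le (x y : R) : Rabs y <= 1 -> Rabs (x * y) <= Rabs x.
Proof. intros H; rewrite Rabs_mult; generalize (Rabs_pos x); nra. Qed.

(** From the amplitude to the averaged probability: replace [u^2 + v^2] by
    [energy / s] with [square_close] and average that with [window_energy]. *)
Lemma window_average (u v : R -> R) (b om g : R -> R) (l : list R) (M : R) :
  (forall s, continuous u s) -> (forall s, continuous v s) -> 0 <= M -> NoDup l ->
  (forall c d, In c l -> In d l -> c <> d -> om c <> om d) ->
  (forall s, 1 <= s ->
     Rabs (u s - lsum (fun c => b c * cos (s * om c + g c)) l / sqrt s) <= M / s) ->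
  (forall s, 1 <= s ->
     Rabs (v s - lsum (fun c => b c * sin (s * om c + g c)) l / sqrt s) <= M / s) ->
  exists M', forall t, 1 <= t ->
    Rabs (/ sqrt t * RInt (fun s => u s ^ 2 + v s ^ 2) t (t + sqrt t)
          - lsum (fun c => b c ^ 2) l / t) <= M' / (t * sqrt t).
Proof.
intros Cu Cv HM Hnd Hom Hu Hv.
destruct (window_energy b om g l Hnd Hom) as [M1 [HM1 B1]].
set (B := lsum (fun c => Rabs (b c)) l).
set (K := M * M + 2 * M * B).
assert (HB : 0 <= B).
{ eapply Rle_trans; [apply (Rabs_pos (lsum b l))|apply lsum_abs_le; intros; lra]. }
assert (HK : 0 <= K) by (unfold K; nra).
exists (M1 + 2 * K); intros t Ht.
assert (S0 := sqrt_lt_R0 t ltac:(lra)); assert (S2 := sqrt_sqrt t ltac:(lra)).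
assert (Sq : forall (f : R -> R) s, continuous f s -> continuous (fun s => f s ^ 2) s).
{ intros f s Cf; apply (continuous_comp f (fun y => y ^ 2)); [exact Cf|cont_derive]. }
assert (Cuv : forall s, continuous (fun s => u s ^ 2 + v s ^ 2) s).
{ intros s; apply (continuous_plus (fun s => u s ^ 2) (fun s => v s ^ 2)); now apply Sq. }
assert (Exuv : ex_RInt (fun s => u s ^ 2 + v s ^ 2) t (t + sqrt t)) by now apply ex_RInt_everywhere.
assert (Exe := ex_RInt_window (energy b om g l) t Ht (energy_continuous b om g l)).
assert (Split : RInt (fun s => 1 * (u s ^ 2 + v s ^ 2) + (-1) * (energy b om g l s / s)) t (t + sqrt t)
  = 1 * RInt (fun s => u s ^ 2 + v s ^ 2) t (t + sqrt t)
    + (-1) * RInt (fun s => energy b om g l s / s) t (t + sqrt t)) by now apply RInt_lin2.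
assert (Err : Rabs (RInt (fun s => 1 * (u s ^ 2 + v s ^ 2) + (-1) * (energy b om g l s / s)) t (t + sqrt t))
   <= (t + sqrt t - t) * (2 * K / (t * sqrt t))).
{ apply abs_RInt_le_const; [lra| |].
  - apply (ex_RInt_plus (V := R_NormedModule) (fun s => 1 * (u s ^ 2 + v s ^ 2)) (fun s => (-1) * (energy b om g l s / s))).
    + now apply (ex_RInt_scal (V := R_NormedModule) (fun s => u s ^ 2 + v s ^ 2)).
    + now apply (ex_RInt_scal (V := R_NormedModule) (fun s => energy b om g l s / s)).
  - intros s Hs.
    assert (A1 := square_close (u s) _ s M B ltac:(lra) HM (lsum_abs_le _ _ l
       (fun c => Rabs_mult_le (b c) _ (Rabs_cos_le (s * om c + g c))))
       (Hu s ltac:(lra))).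
    assert (A2 := square_close (v s) _ s M B ltac:(lra) HM (lsum_abs_le _ _ l
       (fun c => Rabs_mult_le (b c) _ (Rabs_sin_le (s * om c + g c))))
       (Hv s ltac:(lra))).
    fold K in A1, A2.
    assert (Q : K / (s * sqrt s) <= K / (t * sqrt t)).
    { apply Rmult_le_compat_l; [exact HK|]; apply Rinv_le_contravar.
      - apply Rmult_lt_0_compat; lra.
      - apply Rmult_le_compat; try lra; apply sqrt_le_1_alt; lra. }
    unfold energy; set (a1 := lsum (fun c => b c * cos (s * om c + g c)) l) in *.
    set (a2 := lsum (fun c => b c * sin (s * om c + g c)) l) in *.
    replace (1 * (u s ^ 2 + v s ^ 2) + -1 * ((a1 ^ 2 + a2 ^ 2) / s))
      with ((u s ^ 2 - a1 ^ 2 / s) + (v s ^ 2 - a2 ^ 2 / s)) by (field; repeat split; lra).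
    eapply Rle_trans; [apply Rabs_triang|].
    replace (2 * K / (t * sqrt t)) with (K / (t * sqrt t) + K / (t * sqrt t)) by (field; repeat split; lra); lra. }
rewrite Split in Err; specialize (B1 t Ht).
set (I := RInt (fun s => u s ^ 2 + v s ^ 2) t (t + sqrt t) : R) in *.
set (J := RInt (fun s => energy b om g l s / s) t (t + sqrt t) : R) in *.
set (W := lsum _ l) in *; set (r := sqrt t) in *.
replace ((t + r - t) * (2 * K / (t * r))) with (2 * K / t) in Err by (field; repeat split; lra).
replace (/ r * I - W / t) with (/ r * ((1 * I + -1 * J) + (J - W / r)))
  by (rewrite <- S2; field; lra).
rewrite Rabs_mult, Rabs_inv, (Rabs_pos_eq r) by lra.
replace ((M1 + 2 * K) / (t * r)) with (/ r * (2 * K / t + M1 / t)) by (field; repeat split; lra).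
apply Rmult_le_compat_l; [left; now apply Rinv_0_lt_compat|].
eapply Rle_trans; [apply Rabs_triang|]; lra.
Qed.

(** * The return amplitude as an integral *)

Lemma dirac_series (x : R) (p : Z) :
  is_series (zfold (fun j => if Z.eq_dec j p then x else 0)) x.
Proof.
set (k := Z.abs_nat p).
assert (E : forall n, sum_n (zfold (fun j => if Z.eq_dec j p then x else 0)) n = if le_dec k n then x else 0).
{ induction n as [|n IH].
  - rewrite sum_O; unfold zfold; destruct (Z.eq_dec 0 p), (le_dec k 0); try reflexivity;
      exfalso; unfold k in *; lia.
  - rewrite sum_Sn, IH.
    change (zfold ?f (S n)) with (f (Z.of_nat (S n)) + f (- Z.of_nat (S n))%Z); cbv beta.
    unfold plus; cbn -[Z.of_nat Z.eq_dec le_dec].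
    destruct (Z.eq_dec (Z.of_nat (S n)) p), (Z.eq_dec (- Z.of_nat (S n)) p),
      (le_dec k n), (le_dec k (S n)); try (exfalso; unfold k in *; lia); ring. }
change (is_lim_seq (sum_n (zfold (fun j => if Z.eq_dec j p then x else 0))) x).
apply (is_lim_seq_ext_loc (fun _ => x)); [|apply is_lim_seq_const].
exists k; intros n Hn; rewrite E; destruct (le_dec k n); [reflexivity|contradiction].
Qed.

Lemma zfold_plus (u v : Z -> R) n : zfold (fun j => u j + v j) n = zfold u n + zfold v n.
Proof. destruct n; simpl; [reflexivity|unfold plus; simpl; ring]. Qed.

Lemma zfold_ext (u v : Z -> R) n : (forall j, u j = v j) -> zfold u n = zfold v n.
Proof. intros H; destruct n; unfold zfold; now rewrite !H. Qed.

(** Sums over [Z] are defined as limits of symmetric sums around [0]; for summands living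
    near [i] they reduce to the finite sum around [i]. *)
Lemma finite_zseries (v : Z -> R) (i : Z) (L : nat) :
  (forall j, (Z.abs (i - j) > Z.of_nat L)%Z -> v j = 0) ->
  is_series (zfold v) (sum_n (fun n => v (i - (Z.of_nat n - Z.of_nat L))%Z) (2 * L)).
Proof.
intros H.
set (p := fun n : nat => (i - (Z.of_nat n - Z.of_nat L))%Z).
set (d := fun n j => if Z.eq_dec j (p n) then v (p n) else 0).
assert (I : forall N, is_series (zfold (fun j => sum_n (fun n => d n j) N)) (sum_n (fun n => v (p n)) N)).
{ induction N as [|N IH].
  - rewrite sum_O; eapply is_series_ext; [|apply (dirac_series (v (p O)) (p O))].
    intros n; apply zfold_ext; intros j; now rewrite sum_O.
  - rewrite sum_Sn; eapply is_series_ext; [|exact (is_series_plus _ _ _ _ IH (dirac_series (v (p (S N))) (p (S N))))].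
    intros n; unfold plus; simpl; rewrite <- zfold_plus; apply zfold_ext; intros j; now rewrite sum_Sn. }
eapply is_series_ext; [|apply (I (2 * L)%nat)].
intros n; apply zfold_ext; intros j.
assert (S0 : forall N, (forall k, (k <= N)%nat -> p k <> j) -> sum_n (fun n => d n j) N = 0).
{ induction N as [|N IH]; intros Hk.
  - rewrite sum_O; unfold d; destruct (Z.eq_dec j (p O)) as [e|]; [exfalso; apply (Hk O); auto|reflexivity].
  - rewrite sum_Sn, IH by (intros; apply Hk; lia); unfold d.
    destruct (Z.eq_dec j (p (S N))) as [e|]; [exfalso; apply (Hk (S N)); auto|].
    unfold plus; simpl; ring. }
assert (S1 : forall N k, (k <= N)%nat -> p k = j -> sum_n (fun n => d n j) N = v j).
{ induction N as [|N IH]; intros k Hk Hp.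
  - assert (k = O) as -> by lia; rewrite sum_O; unfold d; rewrite Hp.
    destruct (Z.eq_dec j j); [reflexivity|contradiction].
  - rewrite sum_Sn; destruct (Nat.eq_dec k (S N)) as [->|Hne].
    + rewrite S0 by (intros q Hq; rewrite <- Hp; unfold p; lia).
      unfold d; rewrite Hp; destruct (Z.eq_dec j j); [unfold plus; simpl; ring|contradiction].
    + rewrite (IH k) by (lia || exact Hp); unfold d.
      destruct (Z.eq_dec j (p (S N))) as [e|]; [exfalso; unfold p in *; lia|].
      unfold plus; simpl; ring. }
destruct (Z_le_dec (Z.abs (i - j)) (Z.of_nat L)) as [Hj|Hj].
- apply (S1 _ (Z.to_nat (i - j + Z.of_nat L))); [lia|unfold p; lia].
- rewrite H by lia; apply S0; intros k Hk; unfold p; lia.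
Qed.

Lemma finite_ZCSeries (u : Z -> C) (i : Z) (L : nat) :
  (forall j, (Z.abs (i - j) > Z.of_nat L)%Z -> u j = 0%C) ->
  ZCSeries u = sum_n (fun n => u (i - (Z.of_nat n - Z.of_nat L))%Z) (2 * L).
Proof.
intros H; apply injective_projections.
- etransitivity; [|symmetry; apply (sum_n_Cre (fun n => u (i - (Z.of_nat n - Z.of_nat L))%Z))].
  apply is_series_unique; eapply is_series_ext;
    [|apply (finite_zseries (fun j => Re (u j)))].
  + intros [|n]; reflexivity.
  + intros j Hj; now rewrite H.
- etransitivity; [|symmetry; apply (sum_n_Cim (fun n => u (i - (Z.of_nat n - Z.of_nat L))%Z))].
  apply is_series_unique; eapply is_series_ext;
    [|apply (finite_zseries (fun j => Im (u j)))].
  + intros [|n]; reflexivity.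
  + intros j Hj; now rewrite H.
Qed.

Lemma act_convolution X a L f i : finite_support X L -> isotropic X a ->
  act X f i = sum_n (fun n => let l := (Z.of_nat n - Z.of_nat L)%Z in (a l * f (i - l)%Z)%C) (2 * L).
Proof.
intros HL [HX _]; unfold act; rewrite (finite_ZCSeries _ i L).
- apply sum_n_ext; intros n; cbv zeta; rewrite HX; f_equal; f_equal; ring.
- intros j Hj; rewrite HL by exact Hj; apply Cmult_0_l.
Qed.

Ltac toC := match goal with |- @eq _ ?x ?y => change (@eq C x y) end.

(** Componentwise, since a complex coefficient mixes the real and the imaginary part of
    an integral. *)
Definition is_CInt (f : R -> C) (a b : R) (z : C) : Prop :=
  is_RInt (fun x => Re (f x)) a b (Re z) /\ is_RInt (fun x => Im (f x)) a b (Im z).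

Lemma is_CInt_ext f g a b z : (forall x, f x = g x) -> is_CInt f a b z -> is_CInt g a b z.
Proof.
intros H [H1 H2]; split; (eapply is_RInt_ext; [|eassumption]); intros; simpl; now rewrite H.
Qed.

Lemma is_CInt_plus f g a b y z : is_CInt f a b y -> is_CInt g a b z ->
  is_CInt (fun x => f x + g x)%C a b (y + z)%C.
Proof.
intros [F1 F2] [G1 G2]; split.
- exact (is_RInt_plus _ _ _ _ _ _ F1 G1).
- exact (is_RInt_plus _ _ _ _ _ _ F2 G2).
Qed.

Lemma is_CInt_mult f a b c z : is_CInt f a b z -> is_CInt (fun x => c * f x)%C a b (c * z)%C.
Proof.
intros [F1 F2]; split.
- exact (is_RInt_minus _ _ _ _ _ _ (is_RInt_scal _ _ _ (Re c) _ F1) (is_RInt_scal _ _ _ (Im c) _ F2)).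
- exact (is_RInt_plus _ _ _ _ _ _ (is_RInt_scal _ _ _ (Re c) _ F2) (is_RInt_scal _ _ _ (Im c) _ F1)).
Qed.

Lemma is_CInt_sum (F : nat -> R -> C) (z : nat -> C) a b N :
  (forall n, is_CInt (F n) a b (z n)) ->
  is_CInt (fun x => sum_n (fun n => F n x) N) a b (sum_n z N).
Proof.
intros H; induction N as [|N IH].
- rewrite sum_O; apply (is_CInt_ext (F O)); [intros; now rewrite sum_O|apply H].
- rewrite sum_Sn; apply (is_CInt_ext (fun x => sum_n (fun n => F n x) N + F (S N) x)%C);
    [intros; now rewrite sum_Sn|now apply is_CInt_plus].
Qed.

Lemma cis_plus x y : cis (x + y) = (cis x * cis y)%C.
Proof. unfold cis, Cmult; simpl; rewrite cos_plus, sin_plus; f_equal; ring. Qed.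

Lemma cis_period x k : cis (x + 2 * PI * IZR k) = cis x.
Proof.
assert (H : forall y n, cis (y + 2 * INR n * PI) = cis y)
  by (intros; unfold cis; now rewrite cos_period, sin_period).
destruct (Z_le_dec 0 k) as [Hk|Hk].
- replace (IZR k) with (INR (Z.to_nat k)) by (rewrite INR_IZR_INZ; f_equal; lia).
  rewrite <- (H x (Z.to_nat k)); f_equal; ring.
- rewrite <- (H (x + 2 * PI * IZR k) (Z.to_nat (- k))).
  replace (INR (Z.to_nat (- k))) with (- IZR k); [f_equal; ring|].
  rewrite INR_IZR_INZ, <- opp_IZR; f_equal; lia.
Qed.

Lemma cis_integral x0 i :
  is_CInt (fun x => cis (- IZR i * x)) x0 (x0 + 2 * PI) (RtoC (2 * PI) * delta 0 i)%C.
Proof.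
unfold delta; destruct (Z.eq_dec i 0) as [->|Hi].
- split; simpl.
  + apply (is_RInt_ext (fun _ => 1)).
    { intros; rewrite Ropp_0, Rmult_0_l, cos_0; reflexivity. }
    replace (2 * PI * 1 - 0 * 0) with (scal (x0 + 2 * PI - x0) 1) by (unfold scal; simpl; unfold mult; simpl; ring).
    apply (is_RInt_const (V := R_NormedModule)).
  + apply (is_RInt_ext (fun _ => 0)).
    { intros; rewrite Ropp_0, Rmult_0_l, sin_0; reflexivity. }
    replace (2 * PI * 0 + 0 * 1) with (scal (x0 + 2 * PI - x0) 0) by (unfold scal; simpl; unfold mult; simpl; ring).
    apply (is_RInt_const (V := R_NormedModule)).
- assert (k0 : IZR i <> 0) by (now apply not_0_IZR).
  assert (P := cis_period (- IZR i * x0) (- i)); unfold cis in P.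
  replace (- IZR i * x0 + 2 * PI * IZR (- i)) with (- IZR i * (x0 + 2 * PI)) in P
    by (rewrite opp_IZR; ring).
  injection P; intros Ps Pc.
  split; simpl.
  + replace (2 * PI * 0 - 0 * 0) with
     (minus ((fun x => sin (- IZR i * x) / - IZR i) (x0 + 2 * PI)) ((fun x => sin (- IZR i * x) / - IZR i) x0))
     by (simpl; rewrite Ps; unfold minus, plus, opp; simpl; ring).
    apply (is_RInt_derive (V := R_CompleteNormedModule) (fun x => sin (- IZR i * x) / - IZR i)); intros x _.
    * auto_derive; [trivial|field; exact k0].
    * cont_derive.
  + replace (2 * PI * 0 + 0 * 0) with
     (minus ((fun x => cos (- IZR i * x) / IZR i) (x0 + 2 * PI)) ((fun x => cos (- IZR i * x) / IZR i) x0))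
     by (simpl; rewrite Pc; unfold minus, plus, opp; simpl; ring).
    apply (is_RInt_derive (V := R_CompleteNormedModule) (fun x => cos (- IZR i * x) / IZR i)); intros x _.
    * auto_derive; [trivial|field; exact k0].
    * cont_derive.
Qed.

(** In the Fourier picture the walk operator multiplies by the generating function, so
    the [i]-th entry of its [n]-th power applied to [delta 0] is a Fourier coefficient of
    an [n]-th power.  The base case is the only place where orthogonality is used. *)
Lemma iterate_integral X a L t x0 n i : finite_support X L -> isotropic X a ->
  is_CInt (fun x => ((Ci * RtoC t * genfun a L x) ^ n * cis (- IZR i * x))%C) x0 (x0 + 2 * PI)
    (RtoC (2 * PI) * Nat.iter n (fun f i => Ci * RtoC t * act X f i) (delta 0) i)%C.
Proof.
intros HL Ha; revert i; induction n as [|n IH]; intros i.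
- simpl; eapply is_CInt_ext; [|apply cis_integral]; intros x; simpl; now rewrite Cmult_1_l.
- change (Nat.iter (S n) ?A ?d i) with (A (Nat.iter n A d) i).
  set (f := Nat.iter n _ _) in *; cbv beta.
  rewrite (act_convolution X a L f i HL Ha).
  set (l := fun k : nat => (Z.of_nat k - Z.of_nat L)%Z).
  assert (S := is_CInt_sum (fun k x => (a (l k) * ((Ci * t * genfun a L x) ^ n * cis (- IZR (i - l k) * x)))%C)
     (fun k => (a (l k) * (RtoC (2 * PI) * f (i - l k)%Z))%C) x0 (x0 + 2 * PI) (2 * L)
     (fun k => is_CInt_mult _ _ _ _ _ (IH _))).
  apply (is_CInt_mult _ _ _ (Ci * RtoC t)%C) in S.
  replace (RtoC (2 * PI) * (Ci * t * sum_n (fun k => let l := (Z.of_nat k - Z.of_nat L)%Z in (a l * f (i - l)%Z)%C) (2 * L)))%C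
   with (Ci * t * sum_n (fun k => (a (l k) * (RtoC (2 * PI) * f (i - l k)%Z))%C) (2 * L))%C.
  + revert S; apply is_CInt_ext; intros x.
    set (z := (Ci * t * genfun a L x)%C).
    assert (E : sum_n (fun k => (a (l k) * (z ^ n * cis (- IZR (i - l k) * x)))%C) (2 * L)
      = (z ^ n * cis (- IZR i * x) * genfun a L x)%C).
    { unfold genfun; rewrite <- (sum_n_mult_l (K := C_Ring)); apply sum_n_ext; intros k.
      fold (l k); cbv zeta; change (mult ?u ?v) with (u * v)%C.
      replace (- IZR (i - l k) * x) with (- IZR i * x + IZR (l k) * x) by (rewrite minus_IZR; ring).
      rewrite cis_plus; toC; ring. }
    rewrite E; unfold z; simpl; ring.
  + assert (E : sum_n (fun k => (a (l k) * (RtoC (2 * PI) * f (i - l k)%Z))%C) (2 * L)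
      = (RtoC (2 * PI) * sum_n (fun k => (a (l k) * f (i - l k)%Z)%C) (2 * L))%C).
    { rewrite <- (sum_n_mult_l (K := C_Ring)); apply sum_n_ext; intros k.
      change (mult ?u ?v) with (u * v)%C; toC; ring. }
    rewrite E; unfold l; cbv zeta; ring.
Qed.

(** Taylor's formula for [tau => cos (tau x + psi)] on [[0, 1]]; differentiating [m]
    times shifts the phase by [m PI / 2]. *)
Lemma cos_taylor (x psi : R) (n : nat) :
  Rabs (cos (x + psi) - sum_n (fun m => x ^ m / INR (fact m) * cos (INR m * (PI / 2) + psi)) n)
  <= Rabs x ^ S n / INR (fact (S n)).
Proof.
set (f := fun tau => cos (tau * x + psi)).
assert (Dm : forall m tau, Derive_n f m tau = x ^ m * cos (tau * x + (INR m * (PI / 2) + psi))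
   /\ ex_derive (Derive_n f m) tau).
{ assert (Cs : forall m tau, is_derive (fun tau => x ^ m * cos (tau * x + (INR m * (PI / 2) + psi))) tau
     (x ^ S m * cos (tau * x + (INR (S m) * (PI / 2) + psi)))).
  { intros m tau; auto_derive; [trivial|].
    replace (tau * x + (INR (S m) * (PI / 2) + psi))
      with (PI / 2 + (tau * x + (INR m * (PI / 2) + psi))) by (rewrite S_INR; ring).
    set (y := tau * x + _); replace (cos (PI / 2 + y)) with (- sin y) by (rewrite sin_cos; ring).
    simpl; ring. }
  induction m as [|m IH]; intros tau.
  - split; [simpl; unfold f; rewrite Rmult_1_l, Rmult_0_l, Rplus_0_l; reflexivity|].
    simpl; unfold f; auto_derive; trivial.
  - assert (E : forall y, Derive_n f (S m) y = x ^ S m * cos (y * x + (INR (S m) * (PI / 2) + psi))).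
    { intros y; simpl Derive_n; rewrite (Derive_ext _ _ y (fun z => proj1 (IH z))).
      now apply is_derive_unique. }
    split; [apply E|]; eapply ex_derive_ext; [intros y; symmetry; apply E|].
    eexists; apply Cs. }
destruct (Taylor_Lagrange f n 0 1 Rlt_0_1) as [z [_ Hz]].
{ intros tau _ [|k] _; [exact I|apply (Dm k tau)]. }
rewrite (proj1 (Dm _ _)) in Hz.
unfold f at 1 in Hz; rewrite Rmult_1_l in Hz; rewrite Hz, <- sum_n_Reals.
rewrite (sum_n_ext (fun m => (1 - 0) ^ m / INR (fact m) * Derive_n f m 0)
   (fun m => x ^ m / INR (fact m) * cos (INR m * (PI / 2) + psi))).
2: { intros m; rewrite (proj1 (Dm m 0)), Rminus_0_r, pow1, Rmult_0_l, Rplus_0_l.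
     unfold Rdiv; toR; ring. }
set (Sn := sum_n _ _).
assert (F := INR_fact_lt_0 (S n)).
match goal with |- Rabs ?e <= _ => replace e with
  (x ^ S n * / INR (fact (S n)) * cos (z * x + (INR (S n) * (PI / 2) + psi)))
  by (rewrite Rminus_0_r, pow1; toR; field; lra) end.
rewrite Rabs_mult, Rabs_mult, <- RPow_abs, Rabs_inv, (Rabs_pos_eq (INR _)) by lra.
rewrite <- (Rmult_1_r (Rabs x ^ S n / INR (fact (S n)))).
apply Rmult_le_compat_l; [|apply Rabs_cos_le].
apply Rmult_le_pos; [apply pow_le, Rabs_pos|left; now apply Rinv_0_lt_compat].
Qed.

(** The exponential series may be integrated term by term since it converges uniformly
    on bounded sets. *)
Lemma RInt_cos_series (p : R -> R) (psi a b : R) : a <= b -> (forall x, continuous p x) ->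
  is_series (fun n => RInt (fun x => p x ^ n * cos (INR n * (PI / 2) + psi)) a b / INR (fact n))
    (RInt (fun x => cos (p x + psi)) a b).
Proof.
intros Hab Cp.
destruct (bounded_continuity (V := R_NormedModule) p a b) as [B0 HB0]; [intros; apply Cp|].
set (B := Rabs B0).
assert (HB : forall x, a <= x <= b -> Rabs (p x) <= B).
{ intros x Hx; specialize (HB0 x Hx); unfold B; generalize (Rle_abs B0).
  change (norm (p x)) with (Rabs (p x)) in HB0; lra. }
set (u := fun n x => p x ^ n / INR (fact n) * cos (INR n * (PI / 2) + psi)).
assert (Cpow : forall n x, continuous (fun x => p x ^ n) x).
{ intros n x; apply (continuous_comp p (fun y => y ^ n)); [apply Cp|cont_derive]. }
assert (Cu : forall n x, continuous (u n) x).
{ intros n x; unfold u; apply (continuous_ext (fun x => (cos (INR n * (PI / 2) + psi) / INR (fact n)) * p x ^ n)).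
  - intros; unfold Rdiv; toR; ring.
  - apply (continuous_scal_r _ (fun x => p x ^ n)), Cpow. }
assert (Cs : forall N x, continuous (fun x => sum_n (fun n => u n x) N) x).
{ induction N as [|N IH]; intros x.
  - apply (continuous_ext (u O)); [intros; now rewrite sum_O|apply Cu].
  - apply (continuous_ext (fun x => sum_n (fun n => u n x) N + u (S N) x)); [intros; now rewrite sum_Sn|].
    apply (continuous_plus (fun x => sum_n (fun n => u n x) N) (u (S N))); [apply IH|apply Cu]. }
(* Integration term by term of the partial sums, whose uniform error is that of
   the exponential series at B. *)
assert (Part : forall N, sum_n (fun n => RInt (fun x => p x ^ n * cos (INR n * (PI / 2) + psi)) a b / INR (fact n)) N
   = RInt (fun x => sum_n (fun n => u n x) N) a b).
{ assert (One : forall n, RInt (fun x => p x ^ n * cos (INR n * (PI / 2) + psi)) a b / INR (fact n) = RInt (u n) a b).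
  { intros n; unfold Rdiv; rewrite Rmult_comm, <- RInt_scal_R.
    - apply RInt_ext_R; intros; unfold u; unfold Rdiv; ring.
    - apply ex_RInt_everywhere; intros x.
      apply (continuous_mult (fun x => p x ^ n) (fun _ => cos _)); [apply Cpow|apply continuous_const]. }
  induction N as [|N IH].
  - rewrite sum_O, One; apply RInt_ext_R; intros; now rewrite sum_O.
  - rewrite sum_Sn, IH, One.
    rewrite (RInt_ext_R (fun x => sum_n (fun n => u n x) (S N)) (fun x => 1 * sum_n (fun n => u n x) N + 1 * u (S N) x))
      by (intros; rewrite sum_Sn; unfold plus; simpl; ring).
    rewrite RInt_lin2 by (exact (ex_RInt_everywhere _ a b (Cs N)) || exact (ex_RInt_everywhere _ a b (Cu (S N)))).
    rewrite !Rmult_1_l; reflexivity. }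
set (I := RInt (fun x => cos (p x + psi)) a b : R).
assert (Bd : forall N, Rabs (RInt (fun x => sum_n (fun n => u n x) N) a b - I) <= (b - a) * (B ^ S N / INR (fact (S N)))).
{ intros N.
  assert (Exc : ex_RInt (fun x => cos (p x + psi)) a b).
  { apply ex_RInt_everywhere; intros x; apply continuous_cos_comp.
    apply (continuous_plus p (fun _ => psi)); [apply Cp|apply continuous_const]. }
  assert (Exs := ex_RInt_everywhere _ a b (Cs N)).
  assert (E := RInt_lin2 (fun x => sum_n (fun n => u n x) N) (fun x => cos (p x + psi)) 1 (-1) a b Exs Exc).
  replace (RInt (fun x => sum_n (fun n => u n x) N) a b - I) with
    (1 * RInt (fun x => sum_n (fun n => u n x) N) a b + -1 * RInt (fun x => cos (p x + psi)) a b)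
    by (unfold I; toR; ring).
  rewrite <- E; apply abs_RInt_le_const; [exact Hab| |].
  - apply (ex_RInt_plus (V := R_NormedModule) (fun x => 1 * sum_n (fun n => u n x) N) (fun x => -1 * cos (p x + psi))).
    + now apply (ex_RInt_scal (V := R_NormedModule) (fun x => sum_n (fun n => u n x) N)).
    + now apply (ex_RInt_scal (V := R_NormedModule) (fun x => cos (p x + psi))).
  - intros x Hx; assert (T := cos_taylor (p x) psi N).
    rewrite Rabs_minus_sym in T.
    replace (1 * sum_n (fun n => u n x) N + -1 * cos (p x + psi)) with (sum_n (fun n => u n x) N - cos (p x + psi)) by ring.
    eapply Rle_trans; [exact T|].
    apply Rmult_le_compat_r; [left; apply Rinv_0_lt_compat, INR_fact_lt_0|].
    apply pow_incr; split; [apply Rabs_pos|now apply HB]. }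
assert (Lim : is_lim_seq (fun N => (b - a) * (B ^ S N / INR (fact (S N)))) 0).
{ replace (Finite 0) with (Rbar_mult (b - a) 0) by (simpl; f_equal; ring).
  apply is_lim_seq_scal_l.
  apply (is_lim_seq_incr_1 (fun N => B ^ N / INR (fact N))).
  apply ex_series_lim_0; exists (exp B).
  eapply is_series_ext; [|exact (is_exp_Reals B)]; intros n.
  unfold scal; simpl; unfold mult; simpl; rewrite pow_n_pow; unfold Rdiv; ring. }
change (is_lim_seq (sum_n (fun n => RInt (fun x => p x ^ n * cos (INR n * (PI / 2) + psi)) a b / INR (fact n))) I).
apply (is_lim_seq_ext (fun N => RInt (fun x => sum_n (fun n => u n x) N) a b)); [intros; now rewrite Part|].
apply (is_lim_seq_le_le (fun N => I - (b - a) * (B ^ S N / INR (fact (S N)))) _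
   (fun N => I + (b - a) * (B ^ S N / INR (fact (S N))))).
- intros N; assert (Q := Bd N); apply Rabs_le_between in Q; lra.
- replace (Finite I) with (Finite (I - 0)) by (f_equal; ring).
  apply is_lim_seq_minus'; [apply is_lim_seq_const|exact Lim].
- replace (Finite I) with (Finite (I + 0)) by (f_equal; ring).
  apply is_lim_seq_plus'; [apply is_lim_seq_const|exact Lim].
Qed.

Lemma Cpow_imaginary (x : R) (n : nat) :
  ((Ci * RtoC x) ^ n)%C = (x ^ n * cos (INR n * (PI / 2) + 0), x ^ n * cos (INR n * (PI / 2) + - (PI / 2))).
Proof.
assert (H : ((Ci * RtoC x) ^ n)%C = (x ^ n * cos (INR n * (PI / 2)), x ^ n * sin (INR n * (PI / 2)))).
{ induction n as [|n IH].
  - simpl; rewrite Rmult_0_l, cos_0, sin_0; unfold RtoC; f_equal; ring.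
  - simpl Cpow; rewrite IH, S_INR.
    replace ((INR n + 1) * (PI / 2)) with (INR n * (PI / 2) + PI / 2) by ring.
    rewrite cos_plus, sin_plus, cos_PI2, sin_PI2; unfold Cmult, Ci, RtoC; simpl; f_equal; ring. }
rewrite H, Rplus_0_r; do 2 f_equal.
rewrite <- cos_shift, <- cos_neg; f_equal; ring.
Qed.

(** [psi0 (t) = (1 / 2 PI) int exp (i t P)] over any period. *)
Lemma psi0_integral X a L t x0 :
  finite_support X L -> isotropic X a -> (forall x, continuous (rgenfun a L) x) ->
  psi0 X t = (RInt (fun x => cos (t * rgenfun a L x + 0)) x0 (x0 + 2 * PI) / (2 * PI),
              RInt (fun x => cos (t * rgenfun a L x + - (PI / 2))) x0 (x0 + 2 * PI) / (2 * PI)).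
Proof.
intros HL Ha CP.
assert (PP := PI_RGT_0).
assert (Cp : forall x, continuous (fun x => t * rgenfun a L x) x)
  by (intros x; apply (continuous_scal_r t (rgenfun a L)), CP).
assert (P0 : psi0 X t = evolution X t (delta 0) 0%Z).
{ unfold psi0, inner; rewrite (finite_ZCSeries _ 0 0).
  - rewrite sum_O; simpl; unfold delta at 1; simpl.
    apply injective_projections; simpl; ring.
  - intros j Hj; unfold delta at 1; destruct (Z.eq_dec j 0) as [->|]; [exfalso; lia|].
    apply injective_projections; simpl; ring. }
rewrite P0; unfold evolution, op_exp, CSeries.
assert (It : forall n,
   RInt (fun x => (t * rgenfun a L x) ^ n * cos (INR n * (PI / 2) + 0)) x0 (x0 + 2 * PI) / INR (fact n)
     = 2 * PI * Re (op_exp_term (fun f i => Ci * RtoC t * act X f i)%C (delta 0) 0%Z n) /\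
   RInt (fun x => (t * rgenfun a L x) ^ n * cos (INR n * (PI / 2) + - (PI / 2))) x0 (x0 + 2 * PI) / INR (fact n)
     = 2 * PI * Im (op_exp_term (fun f i => Ci * RtoC t * act X f i)%C (delta 0) 0%Z n)).
{ intros n.
  assert (S := iterate_integral X a L t x0 n 0 HL Ha).
  apply (is_CInt_ext _ (fun x => ((t * rgenfun a L x) ^ n * cos (INR n * (PI / 2) + 0),
     (t * rgenfun a L x) ^ n * cos (INR n * (PI / 2) + - (PI / 2))))) in S.
  2: { intros x; rewrite Ropp_0, Rmult_0_l, (genfun_real X a L x Ha), <- Cpow_imaginary.
       unfold cis; rewrite cos_0, sin_0; change (1, 0) with (RtoC 1); rewrite Cmult_1_r.
       f_equal; rewrite <- Cmult_assoc, <- RtoC_mult; reflexivity. }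
  destruct S as [S1 S2]; simpl Re in S1; simpl Im in S2.
  apply (is_RInt_unique (V := R_CompleteNormedModule)) in S1.
  apply (is_RInt_unique (V := R_CompleteNormedModule)) in S2.
  unfold op_exp_term; set (z := Nat.iter _ _ _ _) in *.
  assert (F := INR_fact_lt_0 n).
  assert (E : (z / RtoC (INR (fact n)))%C = (fst z / INR (fact n), snd z / INR (fact n))).
  { unfold Cdiv; rewrite <- RtoC_inv by lra; apply injective_projections; simpl; unfold Rdiv; ring. }
  rewrite E; split; simpl.
  - rewrite S1; field; lra.
  - rewrite S2; field; lra. }
assert (Ser : forall psi (v : nat -> R),
   (forall n, RInt (fun x => (t * rgenfun a L x) ^ n * cos (INR n * (PI / 2) + psi)) x0 (x0 + 2 * PI) / INR (fact n)
     = 2 * PI * v n) ->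
   Series v = RInt (fun x => cos (t * rgenfun a L x + psi)) x0 (x0 + 2 * PI) / (2 * PI)).
{ intros psi v Hv; apply is_series_unique.
  assert (Q := RInt_cos_series (fun x => t * rgenfun a L x) psi x0 (x0 + 2 * PI) ltac:(lra) Cp).
  apply (is_series_scal_l (V := R_NormedModule) (/ (2 * PI))) in Q.
  replace (RInt (fun x => cos (t * rgenfun a L x + psi)) x0 (x0 + 2 * PI) / (2 * PI))
   with (/ (2 * PI) * RInt (fun x => cos (t * rgenfun a L x + psi)) x0 (x0 + 2 * PI)) by (unfold Rdiv; apply Rmult_comm).
  revert Q; apply is_series_ext; intros n; rewrite Hv.
  change (/ (2 * PI) * (2 * PI * v n) = v n); field; lra. }
rewrite (Ser 0 _ (fun n => proj1 (It n))), (Ser (- (PI / 2)) _ (fun n => proj2 (It n))); reflexivity.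
Qed.

(** * The generating function and the return probability *)

(** Differentiating [k] times multiplies by [l^k] and shifts the phase by [k PI / 2]. *)
Definition genfun_derivative (a : Z -> C) (L k : nat) (theta : R) : R :=
  sum_n (fun n => let l := (Z.of_nat n - Z.of_nat L)%Z in
    IZR l ^ k * (Re (a l) * cos (IZR l * theta + INR k * (PI / 2))
               - Im (a l) * sin (IZR l * theta + INR k * (PI / 2)))) (2 * L).

Lemma genfun_derivative_0 a L theta : rgenfun a L theta = genfun_derivative a L 0 theta.
Proof.
unfold rgenfun, genfun, genfun_derivative; rewrite sum_n_Cre; apply sum_n_ext; intros n.
cbv zeta; rewrite Rmult_0_l, Rplus_0_r; unfold Re, Im; simpl; toR; ring.
Qed.

Lemma genfun_tower a L : derivative_tower (genfun_derivative a L).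
Proof.
intros k x.
apply (is_derive_sum_n (V := R_NormedModule)); intros n _; cbv zeta.
set (l := IZR _).
auto_derive; [trivial|].
replace (l * x + INR (S k) * (PI / 2)) with (PI / 2 + (l * x + INR k * (PI / 2))) by (rewrite S_INR; ring).
set (y := l * x + INR k * (PI / 2)).
replace (cos (PI / 2 + y)) with (- sin y) by (rewrite sin_cos; ring).
rewrite <- (cos_sin y); simpl; ring.
Qed.

Lemma Derive_rgenfun a L x : Derive (rgenfun a L) x = genfun_derivative a L 1 x.
Proof.
rewrite (Derive_ext _ _ x (genfun_derivative_0 a L)); apply is_derive_unique, genfun_tower.
Qed.

Lemma Derive_2_rgenfun a L x : Derive_n (rgenfun a L) 2 x = genfun_derivative a L 2 x.
Proof.
etransitivity; [exact (Derive_ext _ _ x (Derive_rgenfun a L))|]; apply is_derive_unique, genfun_tower.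
Qed.

Lemma genfun_derivative_period a L k x :
  genfun_derivative a L k (x + 2 * PI) = genfun_derivative a L k x.
Proof.
unfold genfun_derivative; apply sum_n_ext; intros n; cbv zeta.
set (l := (_ - _)%Z).
assert (P := cis_period (IZR l * x + INR k * (PI / 2)) l); unfold cis in P; injection P; intros Ps Pc.
replace (IZR l * (x + 2 * PI) + INR k * (PI / 2))
  with (IZR l * x + INR k * (PI / 2) + 2 * PI * IZR l) by ring.
now rewrite Ps, Pc.
Qed.

Lemma sum_as_lsum (f : R -> R) (theta : nat -> R) K : (0 < K)%nat ->
  sum_n_m (fun k => f (theta k)) 1 K = lsum f (map theta (seq 1 K)).
Proof.
intros HK; destruct K as [|K]; [lia|clear HK].
assert (App : forall l l', lsum f (l ++ l') = lsum f l + lsum f l').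
{ induction l as [|c l IH]; intros l'; simpl app; rewrite ?lsum_cons, ?lsum_nil; [ring|rewrite IH; ring]. }
induction K as [|K IH].
- rewrite sum_n_n; symmetry; apply Rplus_0_r.
- rewrite sum_n_Sm, IH by lia; rewrite (seq_S (S K)), map_app, App.
  change (lsum f (map theta ((1 + S K)%nat :: nil))) with (f (theta (S (S K))) + 0).
  rewrite Rplus_0_r; reflexivity.
Qed.

Lemma oscillatory_continuous (p : R -> R) psi a b s :
  (forall x, continuous p x) -> continuous (fun s => RInt (fun x => cos (s * p x + psi)) a b) s.
Proof.
intros Cp; apply (is_derive_continuous _ _ (RInt (fun x => - p x * sin (s * p x + psi)) a b)).
assert (C2 : forall u v, continuity_2d_pt (fun u v => u * p v + psi) u v).
{ intros u v; apply (continuity_2d_pt_plus (fun u v => u * p v)); [|apply continuity_2d_pt_const].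
  apply continuity_2d_pt_mult; [apply continuity_2d_pt_id1|].
  apply (continuity_1d_2d_pt_comp p (fun _ v => v)); [apply continuity_pt_of_continuous, Cp|apply continuity_2d_pt_id2]. }
apply (is_derive_RInt_param_global (fun s x => cos (s * p x + psi)) (fun s x => - p x * sin (s * p x + psi)) a b s).
- intros u v; auto_derive; [trivial|ring].
- intros u v; apply (continuity_2d_pt_mult (fun u v => - p v)).
  + apply continuity_2d_pt_opp, (continuity_1d_2d_pt_comp p (fun _ v => v));
      [apply continuity_pt_of_continuous, Cp|apply continuity_2d_pt_id2].
  + apply (continuity_1d_2d_pt_comp sin (fun u v => u * p v + psi)); [apply continuity_pt_of_continuous, continuous_sin|apply C2].
- intros u v; apply continuous_cos_comp, continuous_affine, Cp.
Qed.

Lemma Rpower_three_halves t : 0 < t -> Rpower t (3 / 2) = t * sqrt t.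
Proof.
intros Ht; replace (3 / 2) with (1 + / 2) by field.
now rewrite Rpower_plus, Rpower_1, Rpower_sqrt.
Qed.

Theorem corollary1p3 (X : Z -> Z -> C) (a : Z -> C) (L : nat)
  (K : nat) (theta : nat -> R)
  (HX : hermitian X) (HL : finite_support X L) (Ha : isotropic X a)
  (HK : (0 < K)%nat)
  (Hcrit : forall x : R,
     (0 <= x < 2 * PI /\ Derive (rgenfun a L) x = 0) <->
     (exists k : nat, (1 <= k <= K)%nat /\ x = theta k))
  (Hvals : forall j k : nat, (1 <= j <= K)%nat -> (1 <= k <= K)%nat -> j <> k ->
     rgenfun a L (theta j) <> rgenfun a L (theta k))
  (Hnondeg : forall k : nat, (1 <= k <= K)%nat ->
     Derive_n (rgenfun a L) 2 (theta k) <> 0) :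
  bigO_infty
    (fun t => avg_return_prob X t
       - 1 / (2 * PI * t)
         * sum_n_m (fun k => 1 / Rabs (Derive_n (rgenfun a L) 2 (theta k))) 1 K)
    (fun t => 1 / Rpower t (3 / 2)).
Proof.
assert (PP := PI_RGT_0).
set (P := rgenfun a L) in *; set (D := genfun_derivative a L).
assert (TD : derivative_tower D) by apply genfun_tower.
assert (P0 : forall x, P x = D O x) by apply genfun_derivative_0.
assert (P1 : forall x, Derive P x = D 1%nat x) by apply Derive_rgenfun.
assert (P2 : forall x, Derive_n P 2 x = D 2%nat x) by apply Derive_2_rgenfun.
assert (Per : forall k x, D k (x + 2 * PI) = D k x) by (intros; apply genfun_derivative_period).
assert (CP : forall x, continuous P x).
{ intros x; apply (continuous_ext (D O)); [intros; now rewrite P0|now apply tower_cont]. }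
set (l := map theta (seq 1 K)).
assert (Hl : forall x, In x l <-> exists k, (1 <= k <= K)%nat /\ x = theta k).
{ intros x; unfold l; rewrite in_map_iff; split.
  - intros [k [<- Hk]]; apply in_seq in Hk; exists k; split; [lia|reflexivity].
  - intros [k [Hk ->]]; exists k; split; [reflexivity|apply in_seq; lia]. }
assert (Hcl : forall x, In x l <-> 0 <= x < 2 * PI /\ D 1%nat x = 0).
{ intros x; rewrite Hl, <- Hcrit, P1; reflexivity. }
assert (Hnd : NoDup l).
{ unfold l; apply NoDup_map_NoDup_ForallPairs; [|apply seq_NoDup].
  intros j k Hj Hk E; apply in_seq in Hj, Hk.
  destruct (Nat.eq_dec j k) as [|Hne]; [assumption|].
  exfalso; apply (Hvals j k); [lia|lia|exact Hne|now rewrite E]. }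
assert (Hom : forall c d, In c l -> In d l -> c <> d -> D O c <> D O d).
{ intros c d Hc Hd Hne; apply Hl in Hc, Hd; destruct Hc as [j [Hj ->]], Hd as [k [Hk ->]].
  rewrite <- !P0; apply Hvals; [exact Hj|exact Hk|intros ->; tauto]. }
assert (HD2 : forall c, In c l -> D 2%nat c <> 0).
{ intros c Hc; apply Hl in Hc; destruct Hc as [k [Hk ->]]; rewrite <- P2; now apply Hnondeg. }
(* The stationary phase interval must not begin or end at a critical point, which
   rules out [0, 2 PI].  By periodicity one may start at x0 instead, where x0 + 2 PI
   lies halfway between the last critical point m and 2 PI: no critical point is
   passed, so those of [x0, x0 + 2 PI] are again the theta k. *)
destruct (list_max_split l) as [m [l' [Hp Hm]]].
{ unfold l; destruct K; [lia|discriminate]. }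
assert (Ml : In m l) by (apply (Permutation_in _ (Permutation_sym Hp)); now left).
assert (Mmax : forall x, In x l -> x <= m).
{ intros x Hx; apply (Permutation_in _ Hp) in Hx; destruct Hx as [->|Hx]; [lra|now apply Hm]. }
destruct (proj1 (Hcl m) Ml) as [Hm0 _].
set (x0 := (m - 2 * PI) / 2).
assert (NC : forall x, m < x < 2 * PI -> D 1%nat x <> 0).
{ intros x Hx E; assert (In x l) as Q by (apply Hcl; split; [lra|exact E]).
  specialize (Mmax x Q); lra. }
assert (N2 : D 1%nat (x0 + 2 * PI) <> 0) by (apply NC; unfold x0; lra).
assert (N1 : D 1%nat x0 <> 0) by now rewrite <- Per.
assert (Hin : forall x, In x l <-> x0 <= x <= x0 + 2 * PI /\ D 1%nat x = 0).
{ intros x; rewrite Hcl; split; intros [Hx E].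
  - assert (x <= m) by (apply Mmax, Hcl; tauto).
    split; [unfold x0; lra|exact E].
  - split; [|exact E]; destruct (Rlt_or_le x 0) as [Hneg|Hpos]; [|unfold x0 in *; lra].
    exfalso; apply (NC (x + 2 * PI)); [unfold x0 in *; lra|now rewrite Per]. }
destruct stationary_phase as [gam Hgam].
destruct (Hgam D TD l x0 (x0 + 2 * PI)) as [M [HM B]]; auto; [lra|].
set (U := fun psi s => RInt (fun x => cos (s * D O x + psi)) x0 (x0 + 2 * PI) : R).
set (b := fun c => sqrt (2 * PI / Rabs (D 2%nat c))).
set (g := fun c => sign (D 2%nat c) * gam).
destruct (window_average (U 0) (U (- (PI / 2))) b (D O) g l M) as [M' HM']; auto.
- intros s; apply oscillatory_continuous; intros; now apply tower_cont.
- intros s; apply oscillatory_continuous; intros; now apply tower_cont.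
- intros s Hs; rewrite (lsum_ext _ (stationary_term D gam s 0)); [apply B; lra|].
  intros c _; unfold stationary_term, b, g; now rewrite Rplus_0_r.
- intros s Hs; rewrite (lsum_ext _ (stationary_term D gam s (- (PI / 2)))); [apply B; lra|].
  intros c _; unfold stationary_term, b, g; f_equal.
  rewrite <- cos_shift, <- cos_neg; f_equal; ring.
- exists (/ (4 * PI ^ 2) * M'), 1; intros t Ht.
  specialize (HM' t Ht).
  assert (S0 := sqrt_lt_R0 t ltac:(lra)).
  rewrite Rpower_three_halves by lra.
  assert (Q0 : 0 < / (4 * PI ^ 2)) by (apply Rinv_0_lt_compat; nra).
  (* |psi0|^2 = (U_0^2 + U_(- PI / 2)^2) / (2 PI)^2 *)
  assert (Avg : avg_return_prob X t
     = / (4 * PI ^ 2) * (/ sqrt t * RInt (fun s => U 0 s ^ 2 + U (- (PI / 2)) s ^ 2) t (t + sqrt t))).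
  { unfold avg_return_prob.
    rewrite (RInt_ext_R _ (fun s => / (4 * PI ^ 2) * (U 0 s ^ 2 + U (- (PI / 2)) s ^ 2))).
    - rewrite RInt_scal_R; [toR; ring|].
      apply ex_RInt_everywhere; intros s.
      assert (Sq : forall psi, continuous (fun s => U psi s ^ 2) s).
      { intros psi; apply (continuous_comp (U psi) (fun y => y ^ 2)); [|cont_derive].
        apply oscillatory_continuous; intros; now apply tower_cont. }
      apply (continuous_plus (fun s => U 0 s ^ 2) (fun s => U (- (PI / 2)) s ^ 2)); apply Sq.
    - intros s _; rewrite (psi0_integral X a L s x0 HL Ha CP).
      assert (EU : forall psi, RInt (fun x => cos (s * rgenfun a L x + psi)) x0 (x0 + 2 * PI) = U psi s).
      { intros psi; apply RInt_ext_R; intros x _; fold P; now rewrite P0. }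
      rewrite !EU; unfold Cmod; rewrite pow2_sqrt.
      + simpl; field; lra.
      + apply Rplus_le_le_0_compat; apply pow2_ge_0. }
  rewrite Avg.
  assert (Sum : sum_n_m (fun k => 1 / Rabs (Derive_n P 2 (theta k))) 1 K
     = / (2 * PI) * lsum (fun c => b c ^ 2) l).
  { rewrite (sum_as_lsum (fun c => 1 / Rabs (Derive_n P 2 c)) theta K HK), <- lsum_scal.
    apply lsum_ext; intros c Hc; rewrite P2; unfold b.
    assert (0 < Rabs (D 2%nat c)) by now apply Rabs_pos_lt, HD2.
    rewrite pow2_sqrt; [field; lra|].
    left; apply Rdiv_lt_0_compat; lra. }
  rewrite Sum.
  set (J := / sqrt t * _) in *; set (W := lsum _ l) in *.
  replace (/ (4 * PI ^ 2) * J - 1 / (2 * PI * t) * (/ (2 * PI) * W))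
    with (/ (4 * PI ^ 2) * (J - W / t)) by (field; lra).
  rewrite Rabs_mult, (Rabs_pos_eq (/ _)) by lra.
  rewrite Rmult_assoc; apply Rmult_le_compat_l; [lra|].
  eapply Rle_trans; [exact HM'|].
  rewrite Rabs_pos_eq; [right; field; split; lra|].
  apply Rlt_le, Rdiv_lt_0_compat; [lra|now apply Rmult_lt_0_compat; lra].
Qed.
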